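(* Let $c>0$ and let $$A=\mathop{\dot\bigcup}_{i=1}^{M}A_i,\qquad B=\mathop{\dot\bigcup}_{j=1}^{K}B_j$$ be finite measurable partitions of subsets $A,B$ of $\mathbb R$ into bounded pieces of finite measure, with null pieces discarded. Let $\mathbf N=(N_{ji})_{1\le j\le K,\,1\le i\le M}$ with $N_{ji}\in\mathbb N_0$, and let $\mathbf E^{\rm best}(\mathbf N)$, $\mathbf E^{\rm mom}(\mathbf N)$, $\mathbf E^{\rm diam}(\mathbf N)$ be the nonnegative $K\times M$ matrices defined in the context, with norms taken as operators $\ell^2_M\to\ell^2_K$. Then $$s_{1+\sum_{j,i}N_{ji}}(K_{A,B,c})\le\|\mathbf E^{\rm best}(\mathbf N)\|_{\ell^2_M\to\ell^2_K}.$$ Moreover, entrywise, $$0\le\mathbf E^{\rm best}(\mathbf N)_{ji}\le\mathbf E^{\rm mom}(\mathbf N)_{ji}\le\mathbf E^{\rm diam}(\mathbf N)_{ji},$$ and hence $$\|\mathbf E^{\rm best}(\mathbf N)\|\le\|\mathbf E^{\rm mom}(\mathbf N)\|\le\|\mathbf E^{\rm diam}(\mathbf N)\|.$$ Consequently, for $0<\epsilon<1/2$, any one of the conditions $$\|\mathbf E^{\rm best}(\mathbf N)\|\le\sqrt\epsilon,\qquad\|\mathbf E^{\rm mom}(\mathbf N)\|\le\sqrt\epsilon,\qquad\|\mathbf E^{\rm diam}(\mathbf N)\|\le\sqrt\epsilon$$ implies $$\Lambda_\epsilon(A,cB)\le\sum_{j,i}N_{ji}.$$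
   Context: $P_E$ is multiplication by the indicator of $E$ on $L^2(\mathbb R)$; $(\mathcal Ff)(\xi)=\int_{\mathbb R}e^{-2\pi i x\xi}f(x)\,dx$; $K_{A,B,c}=P_{cB}\mathcal FP_A$; $\Lambda_\epsilon(A,cB):=\operatorname{rank}\mathbf 1_{(\epsilon,1-\epsilon)}(K_{A,B,c}^*K_{A,B,c})$; $s_1\ge s_2\ge\cdots$ are singular values. If $A$ or $B$ is null, the count and all envelopes are understood to be zero. For a measurable $E\subset\mathbb R$ of finite measure, $\mu_N(E):=\inf_{a\in\mathbb R}\int_E|x-a|^{2N}\,dx$ (so $\mu_0(E)=|E|$). $\mathcal P_{-1}=\{0\}$ and, for $N\ge1$, $\mathcal P_{N-1}$ is the space of complex polynomials of degree at most $N-1$. With $d_i=\operatorname{diam}_{\rm ess}(A_i)$, $e_j=\operatorname{diam}_{\rm ess}(B_j)$, where $\operatorname{diam}_{\rm ess}(E)=\operatorname{ess\,sup}_{x,y\in E}|x-y|$, the matrices are $$\mathbf E^{\rm mom}(\mathbf N)_{ji}:=\frac{(2\pi c)^{N_{ji}}\sqrt c}{N_{ji}!}\bigl(\mu_{N_{ji}}(A_i)\mu_{N_{ji}}(B_j)\bigr)^{1/2},$$ $$\mathbf E^{\rm best}(\mathbf N)_{ji}:=\sqrt c\inf_{\alpha,\beta\in\mathbb R,\ p\in\mathcal P_{N_{ji}-1}}\left(\int_{A_i}\int_{B_j}\left|e^{-2\pi i c(x-\alpha)(\eta-\beta)}-p\bigl((x-\alpha)(\eta-\beta)\bigr)\right|^2d\eta\,dx\right)^{1/2},$$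 $$\mathbf E^{\rm diam}(\mathbf N)_{ji}:=\sqrt{c|A_i||B_j|}\,\frac{\bigl(\frac{\pi c}{2}d_ie_j\bigr)^{N_{ji}}}{N_{ji}!}.$$ All three equal $\sqrt{c|A_i||B_j|}$ at order zero. (In the exponent $e^{-2\pi i c(\cdot)}$, $i$ is the imaginary unit.) *)

(* Defs.v *)
From HB Require Import structures.
From mathcomp Require Import all_boot all_order all_algebra.
From mathcomp Require Import complex.
From mathcomp Require Import all_classical all_reals all_analysis.
From mathcomp Require Import ess_sup_inf.

Set Implicit Arguments.
Unset Strict Implicit.
Unset Printing Implicit Defensive.

Import Order.TTheory GRing.Theory Num.Theory.
Import numFieldNormedType.Exports.

Local Open Scope classical_set_scope.
Local Open Scope complex_scope.
Local Open Scope ring_scope.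

(** The real line with its Lebesgue-measurable sets: the carrier is [R] and the
    sigma-algebra is the completion of the Borel one. *)
Notation lebR R := (caratheodory_type ((@wlength R idfun)^*)%mu).

Section HilbertSpace.
Variable R : realType.
Local Notation C := R[i].
Local Notation mu := (@completed_lebesgue_measure R).
Local Notation lmeasurable_fun f := (measurable_fun [set: lebR R] (f : lebR R -> R)).

(** Elements of L^2(R) are complex functions on the line satisfying [L2]; they
    are not quotiented, so equality in L^2(R) is [ae_eq_fn] and an operator on
    L^2(R) is a map between functions. *)
Definition fn := R -> C.
Definition op := fn -> fn.

Definition cintegral (f : fn) : C :=
  (\int[mu]_x complex.Re (f x)) +i* (\int[mu]_x complex.Im (f x)).

Definition ae_eq_fn (f g : fn) : Prop := {ae mu, forall x, f x = g x}.

Definition L2 (f : fn) : Prop :=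
  [/\ lmeasurable_fun (fun x => complex.Re (f x)),
      lmeasurable_fun (fun x => complex.Im (f x)) &
      (\int[mu]_x ((Normc.normc (f x)) ^+ 2)%:E < +oo)%E].

Definition inner (f g : fn) : C := cintegral (fun x => f x * (g x)^*).

Definition lincomb n (a : 'I_n -> C) (f : 'I_n -> fn) : fn :=
  fun x => \sum_(k < n) a k * f k x.

Definition lin_indep n (f : 'I_n -> fn) : Prop :=
  forall a : 'I_n -> C, ae_eq_fn (lincomb a f) (fun=> 0) -> forall k, a k = 0.

Definition orthonormal n (f : 'I_n -> fn) : Prop :=
  (forall k, L2 (f k)) /\ forall k l, inner (f k) (f l) = (k == l)%:R.

Definition linear_op (T : op) : Prop :=
  [/\ forall f, L2 f -> L2 (T f),
      forall f g, L2 f -> L2 g -> ae_eq_fn f g -> ae_eq_fn (T f) (T g) &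
      forall (a : C) f g, L2 f -> L2 g ->
        ae_eq_fn (T (fun x => a * f x + g x)) (fun x => a * T f x + T g x)].

Definition is_adjoint (T S : op) : Prop :=
  (forall g, L2 g -> L2 (S g)) /\
  forall f g, L2 f -> L2 g -> inner (T f) g = inner f (S g).

(** Every bounded operator has an adjoint, unique up to [ae_eq_fn]; the default
    value given to [xget] is irrelevant for those. *)
Definition adjoint (T : op) : op := xget (fun _ _ => 0) [set S | is_adjoint T S].

(** Dimension of the range, as a supremum of numbers of linearly independent
    vectors; it is [+oo] for an operator of infinite rank. *)
Definition oprank (T : op) : \bar R :=
  ereal_sup [set n%:R%:E | n in [set n | exists f : 'I_n -> fn,
    (forall k, L2 (f k)) /\ lin_indep (fun k => T (f k))]].

Definition orth_projection (P : op) : Prop :=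
  [/\ linear_op P,
      forall f, L2 f -> ae_eq_fn (P (P f)) (P f) &
      forall f g, L2 f -> L2 g -> inner (P f) g = inner f (P g)].

(** [E] is the spectral measure (resolution of the identity on the Borel sets)
    of the bounded self-adjoint operator [T]: its values are orthogonal
    projections, and every [f] yields the measure [X |-> <E(X) f, f>], which
    represents the quadratic form of [T].  Countable additivity of [E] is that
    of these measures. *)
Definition is_spectral_measure (T : op) (E : set R -> op) : Prop :=
  [/\ forall X, measurable X -> orth_projection (E X),
      forall f, L2 f -> ae_eq_fn (E setT f) f,
      forall X Y f, measurable X -> measurable Y -> L2 f ->
        ae_eq_fn (E (X `&` Y) f) (E X (E Y f)) &
      forall f, L2 f ->
        exists m : {measure set R -> \bar R},
          [/\ forall X, measurable X -> m X = (complex.Re (inner (E X f) f))%:E,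
              m.-integrable setT EFin &
              inner (T f) f = (\int[m]_t t)%:C]].

(** The spectral theorem provides a spectral measure for every bounded
    self-adjoint operator, unique up to [ae_eq_fn]; the default value given to
    [xget] is irrelevant for those. *)
Definition spectral_measure (T : op) : set R -> op :=
  xget (fun _ _ _ => 0) [set E | is_spectral_measure T E].

(** The [n]-th singular value ([n >= 1]) of a compact operator is the square
    root of the [n]-th largest eigenvalue of [T^* T], eigenvalues being repeated
    according to multiplicity: the largest [l] such that there are [n]
    orthonormal eigenvectors with eigenvalues at least [l]. *)
Definition singular_value (T : op) (n : nat) : \bar R :=
  ereal_sup [set (Num.sqrt l)%:E | l in [set l : R |
    exists f : 'I_n -> fn, orthonormal f /\
      forall k, exists2 m : R, l <= m &
        ae_eq_fn (adjoint T (T (f k))) (fun x => m%:C * f k x)]].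

(** exp(-2 pi i t); note the sign. *)
Definition expi (t : R) : C := cos (2 * pi * t) -i* sin (2 * pi * t).

Definition proj (E : set R) : op := fun f x => if x \in E then f x else 0.

Definition fourier : op := fun f xi => cintegral (fun x => expi (x * xi) * f x).

Definition dilate (c : R) (B : set R) : set R := [set c * x | x in B].

(** When [A] has finite measure, [proj A f] is integrable for every [f] in
    L^2(R), so that the integral in [fourier] is absolutely convergent and
    agrees with the Fourier-Plancherel transform. *)
Definition locop (A B : set R) (c : R) : op :=
  fun f => proj (dilate c B) (fourier (proj A f)).

(** The rank of 1_(eps, 1 - eps)(K^* K). *)
Definition spectral_count (eps : R) (A B : set R) (c : R) : \bar R :=
  oprank (spectral_measure (fun f => adjoint (locop A B c) (locop A B c f))
            `]eps, 1 - eps[%classic).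

End HilbertSpace.

(** [P] is a partition of [A] into bounded measurable pieces from which the null
    pieces have been discarded; hence [A] is the union of the [P i] only up to a
    null set, and [n = 0] when [A] is null. *)
Definition partition_nonnull (R : realType) (n : nat) (P : 'I_n -> set R)
    (A : set R) : Prop :=
  let mu := @completed_lebesgue_measure R in
  [/\ measurable (A : set (lebR R)),
      forall i, [/\ measurable (P i : set (lebR R)), P i `<=` A,
                    bounded_set (P i) & (0 < mu (P i) < +oo)%E],
      trivIset setT P &
      mu (A `\` \bigcup_i P i) = 0%E].

Section Envelopes.
Variable R : realType.
Local Notation C := R[i].
Local Notation mu := (@completed_lebesgue_measure R).

(** Norm of a real matrix as an operator from complex l^2_n to complex l^2_m. *)
Definition l2norm n (x : 'cV[C]_n) : R :=
  Num.sqrt (\sum_(k < n) (Normc.normc (x k 0)) ^+ 2).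

Definition opnorm m n (E : 'M[R]_(m, n)) : R :=
  sup [set l2norm (map_mx (real_complex R) E *m x) |
       x in [set x : 'cV[C]_n | l2norm x <= 1]].

Definition moment (N : nat) (E : set R) : R :=
  inf [set \int[mu]_(x in E) `|x - a| ^+ (2 * N) | a in [set: R]].

Definition meas (E : set R) : R := fine (mu E).

(** The integrand is nonnegative, so its extension by zero outside [E * E] does
    not change the essential supremum. *)
Definition diam_ess (E : set R) : R :=
  fine (ess_sup (mu \x mu)%E
    (fun z => (if (z.1 \in E) && (z.2 \in E) then `|z.1 - z.2| else 0)%:E)).

Definition best_error (c : R) (A B : set R) (alpha beta : R)
    (p : {poly C}) : R :=
  Num.sqrt (\int[mu]_(x in A) \int[mu]_(eta in B)
    (Normc.normc (expi (c * (x - alpha) * (eta - beta))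
                  - p.[((x - alpha) * (eta - beta))%:C])) ^+ 2).

Variables (c : R) (M K : nat) (A : 'I_M -> set R) (B : 'I_K -> set R).
Variable N : 'M[nat]_(K, M).

(** For [N j i = 0] the condition [size p <= N j i] forces [p = 0]. *)
Definition Ebest : 'M[R]_(K, M) := \matrix_(j, i)
  (Num.sqrt c * inf [set y | exists alpha beta (p : {poly C}),
     (size p <= N j i)%N /\ y = best_error c (A i) (B j) alpha beta p]).

Definition Emom : 'M[R]_(K, M) := \matrix_(j, i)
  ((2 * pi * c) ^+ N j i * Num.sqrt c / (N j i)`!%:R
   * Num.sqrt (moment (N j i) (A i) * moment (N j i) (B j))).

Definition Ediam : 'M[R]_(K, M) := \matrix_(j, i)
  (Num.sqrt (c * meas (A i) * meas (B j))
   * (pi * c / 2 * diam_ess (A i) * diam_ess (B j)) ^+ N j i / (N j i)`!%:R).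

End Envelopes.

(* Main.v *)
(** On a block [A_i * B_j], factoring out of the kernel [exp(-2 pi i c x eta)] the
    unimodular function [exp(-2 pi i c (x beta + alpha eta - alpha beta))] and
    replacing the remaining [exp(-2 pi i c (x - alpha) (eta - beta))] by a
    polynomial of size at most [N_ji] in [(x - alpha) (eta - beta)] changes the
    block by an operator whose Hilbert-Schmidt norm is the block error, and the
    replacement sees a function [f] only through [N_ji] moments.  Among more than
    [sum N_ji] functions some nonzero combination [f] has no moments at all; for it
    [|K f|] is at most the norm of the matrix of block errors times [|f|].

    Applied to eigenvectors of [K^* K], this bounds the singular value.  Applied to
    the range of the spectral projection, it contradicts [|K f|^2 > eps |f|^2].
    Since the infimum defining a block error need not be attained, [|K f|] is
    controlled only up to an arbitrarily small slack; on the finite-dimensional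
    span at hand, the hermitian form [|K f|^2 - eps |f|^2] is positive definite,
    hence bounded below, which leaves room for the slack.

    The moment envelope comes from Taylor's polynomial, and the diameter envelope
    from centring the moments at the midpoint of the essential hull. *)
Require Import Defs.
From mathcomp Require Import all_boot all_order all_algebra.
From mathcomp Require Import complex.
From mathcomp Require Import all_classical all_reals all_analysis.
From mathcomp Require Import ess_sup_inf measurable_realfun.
From mathcomp Require Import ring lra.

Set Implicit Arguments.
Unset Strict Implicit.
Unset Printing Implicit Defensive.

Import Order.TTheory GRing.Theory Num.Theory.
Import numFieldNormedType.Exports.

Local Open Scope classical_set_scope.
Local Open Scope ring_scope.

(** * Finite-dimensional linear algebra and a weighted Cauchy-Schwarz inequality *)

Section Finite_dimension.

(** The matrix norm enters through an inequality at each single frequency. With [v_i] the norm of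
    [f] on [A_i] and [b_ji] an upper bound of the block error, the Cauchy-Schwarz inequality with
    weights [b_ji] is linear in the squared errors, so that integrating it over [B_j] gives at most
    [(sum_i b_ji v_i)^2]. These weights are divided by and must be positive, while a block error may
    vanish; the slack serves here a second time.

    The moments depend on the centres of the blocks, so the centres have to be fixed before [f] is
    chosen. They depend on the slack alone, and for the rank the slack is computed from Gram
    matrices of the given vectors before the vanishing combination is selected.

    [adjoint] and [spectral_measure] are values of [xget]. Each argument about them has two cases:
    the value has its defining property, or it is the zero default, for which the bound is checked
    directly. *)

Lemma common_kernel (F : fieldType) (J : finType) n (L : 'I_n -> J -> F) :
  (#|J| < n)%N ->
  exists a : 'I_n -> F, (exists k, a k != 0) /\
    forall l, \sum_k a k * L k l = 0.
Proof.
move=> Jn; pose A : 'M[F]_(n, #|J|) := \matrix_(k, l) L k (enum_val l).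
have /rowV0Pn[v /sub_kermxP vA v0] : kermx A != 0.
  by rewrite kermx_eq0 /row_free neq_ltn (leq_ltn_trans (rank_leq_col A) Jn).
exists (v 0); split=> [|l].
  by apply/existsP; move: v0; apply: contraNT; rewrite negb_exists => /forallP v0;
    apply/eqP/rowP => k; rewrite mxE; apply/eqP; have := v0 k; rewrite negbK.
have /rowP/(_ (enum_rank l)) := vA; rewrite !mxE; apply: etrans.
by apply: eq_bigr => k _; rewrite !mxE enum_rankK.
Qed.

(** Cauchy-Schwarz for the factorisation of [s_i v_i] into [sqrt (b_i v_i)] and
    [s_i sqrt (v_i / b_i)]. The right-hand side is linear in the [s_i ^+ 2], so it can be integrated
    when these are functions; it does the work of Minkowski's inequality. The proof is Lagrange's
    identity: after symmetrising the double sum, each difference is a square with a nonnegative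
    coefficient. *)
Lemma weighted_cauchy_schwarz (R : realFieldType) M (b s v : 'I_M -> R) :
  (forall i, 0 < b i) -> (forall i, 0 <= v i) ->
  (\sum_i s i * v i) ^+ 2 <=
  (\sum_i b i * v i) * \sum_i v i / b i * (s i) ^+ 2.
Proof.
move=> b0 v0.
rewrite expr2 mulr_suml mulr_suml.
under eq_bigr do rewrite mulr_sumr.
under [leRHS]eq_bigr do rewrite mulr_sumr.
pose X i k := b i * v i * (v k / b k * s k ^+ 2).
have E : \sum_i \sum_k X i k = 2^-1 * \sum_i \sum_k (X i k + X k i).
  under [in RHS]eq_bigr do rewrite big_split.
  by rewrite big_split/= [in X in _ + X]exchange_big/=; lra.
rewrite [leRHS]E mulr_sumr ler_sum// => i _.
rewrite mulr_sumr ler_sum// => k _.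
rewrite -subr_ge0.
have -> : 2^-1 * (X i k + X k i) - s i * v i * (s k * v k) =
    2^-1 * (v i * v k / (b i * b k)) * (b i * s k - b k * s i) ^+ 2.
  by rewrite /X; field; rewrite !gt_eqF.
by rewrite mulr_ge0 ?sqr_ge0// mulr_ge0// divr_ge0 ?mulr_ge0// ltW.
Qed.

End Finite_dimension.

(** * Real and imaginary parts, conjugation and modulus *)

Section Complex_parts.
Context {R : rcfType}.
Implicit Types z w : R[i].

Lemma cReD z w : complex.Re (z + w) = complex.Re z + complex.Re w.
Proof. by case: z w => [? ?] [? ?]. Qed.

Lemma cImD z w : complex.Im (z + w) = complex.Im z + complex.Im w.
Proof. by case: z w => [? ?] [? ?]. Qed.

Lemma cReN z : complex.Re (- z) = - complex.Re z.
Proof. by case: z. Qed.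

Lemma cReM z w :
  complex.Re (z * w) = complex.Re z * complex.Re w - complex.Im z * complex.Im w.
Proof. by case: z w => [? ?] [? ?]. Qed.

Lemma cImM z w :
  complex.Im (z * w) = complex.Re z * complex.Im w + complex.Im z * complex.Re w.
Proof. by case: z w => [? ?] [? ?]. Qed.

Lemma cRe_sum (I : Type) (r : seq I) (P : pred I) (F : I -> R[i]) :
  complex.Re (\sum_(i <- r | P i) F i) = \sum_(i <- r | P i) complex.Re (F i).
Proof. exact: (big_morph _ cReD (erefl _)). Qed.

Lemma cReJ z : complex.Re z^*%C = complex.Re z.
Proof. by case: z. Qed.

Lemma cImJ z : complex.Im z^*%C = - complex.Im z.
Proof. by case: z. Qed.

Lemma cJM z w : (z * w)^*%C = z^*%C * w^*%C.
Proof. exact: (rmorphM (@conjc R)). Qed.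

Lemma cJ_sum (I : Type) (r : seq I) (P : pred I) (F : I -> R[i]) :
  (\sum_(i <- r | P i) F i)^*%C = \sum_(i <- r | P i) (F i)^*%C.
Proof. exact: (rmorph_sum (@conjc R)). Qed.

Lemma normc_nneg z : 0 <= Normc.normc z.
Proof. by case: z => x y /=; rewrite sqrtr_ge0. Qed.

Lemma normc_real (x : R) : Normc.normc x%:C%C = `|x|.
Proof. by rewrite /= expr0n addr0 sqrtr_sqr. Qed.

Lemma normc_sqrE z : Normc.normc z ^+ 2 = complex.Re z ^+ 2 + complex.Im z ^+ 2.
Proof. by case: z => x y /=; rewrite sqr_sqrtr// addr_ge0 ?sqr_ge0. Qed.

End Complex_parts.

(** * The matrix norm: boundedness, monotonicity and homogeneity *)

Section Operator_norm.
Context {R : realType}.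
Local Notation C := R[i].
Implicit Types (m n : nat).

Lemma normc_sum (I : Type) (r : seq I) (P : pred I) (F : I -> C) :
  Normc.normc (\sum_(i <- r | P i) F i) <= \sum_(i <- r | P i) Normc.normc (F i).
Proof.
elim/big_ind2 : _ => [|x a y b xa yb|//]; first by rewrite Normc.normc0.
by rewrite (le_trans (le_normcD _ _))// lerD.
Qed.

Lemma l2norm_sqr n (x : 'cV[C]_n) :
  l2norm x ^+ 2 = \sum_k Normc.normc (x k 0) ^+ 2.
Proof. by rewrite sqr_sqrtr// sumr_ge0// => k _; rewrite sqr_ge0. Qed.

Lemma le_l2norm m (x y : 'cV[C]_m) :
  (forall k, Normc.normc (x k 0) <= Normc.normc (y k 0)) ->
  l2norm x <= l2norm y.
Proof.
by move=> xy; rewrite ler_wsqrtr// ler_sum// => k _;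
  rewrite lerXn2r ?nnegrE ?normc_nneg.
Qed.

(** Passing to the moduli of the coordinates keeps [l2norm x], and by the triangle inequality it can
    only increase each row of a nonnegative matrix. Monotonicity of [opnorm] rests on this. *)
Lemma l2norm_absE m n (E : 'M[R]_(m, n)) (x : 'cV[C]_n) (E' : 'M[R]_(m, n)) :
  (forall j i, 0 <= E j i <= E' j i) ->
  l2norm (map_mx (real_complex R) E *m x) <=
  l2norm (map_mx (real_complex R) E' *m
          map_mx (fun z => (Normc.normc z)%:C%C) x).
Proof.
move=> EE'; apply: le_l2norm => k; rewrite !mxE.
rewrite [X in _ <= Normc.normc X](_ : _ =
    (\sum_i E' k i * Normc.normc (x i 0))%:C%C); last first.
  by rewrite rmorph_sum; apply: eq_bigr => i _; rewrite !mxE rmorphM.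
rewrite normc_real (le_trans (normc_sum _ _ _))//.
rewrite (le_trans _ (ler_norm _))// ler_sum// => i _.
have /andP[E0 EE] := EE' k i.
rewrite Normc.normcM !mxE normc_real ger0_norm//.
by rewrite ler_wpM2r// normc_nneg.
Qed.

(** [sup] is a least upper bound only for nonempty sets that are bounded above. In the unit ball
    every coordinate has modulus at most 1, whence the row sums. *)
Lemma opnorm_has_ubound m n (E : 'M[R]_(m, n)) :
  has_ubound [set l2norm (map_mx (real_complex R) E *m x) |
               x in [set x : 'cV[C]_n | l2norm x <= 1]].
Proof.
exists (Num.sqrt (\sum_(k < m) (\sum_i `|E k i|) ^+ 2)) => _ [x /= x1 <-].
rewrite ler_wsqrtr// ler_sum// => k _.
rewrite lerXn2r ?nnegrE ?normc_nneg ?sumr_ge0// !mxE.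
rewrite (le_trans (normc_sum _ _ _))// ler_sum// => i _.
rewrite Normc.normcM mxE normc_real ler_piMr//.
rewrite -(expr_le1 (n := 2))// ?normc_nneg//.
have : l2norm x ^+ 2 <= 1 by rewrite expr_le1// sqrtr_ge0.
rewrite l2norm_sqr; apply: le_trans.
by rewrite (bigD1 i)//= lerDl sumr_ge0// => j _; rewrite sqr_ge0.
Qed.

Lemma opnorm_ub m n (E : 'M[R]_(m, n)) (x : 'cV[C]_n) :
  l2norm x <= 1 -> l2norm (map_mx (real_complex R) E *m x) <= opnorm E.
Proof. by move=> x1; apply: ub_le_sup; [exact: opnorm_has_ubound|exists x]. Qed.

Lemma opnorm_ge0 m n (E : 'M[R]_(m, n)) : 0 <= opnorm E.
Proof.
apply: le_trans (opnorm_ub E (x := 0) _); first exact: sqrtr_ge0.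
rewrite /l2norm big1 ?sqrtr0// => k _.
by rewrite mxE Normc.normc0 expr0n.
Qed.

Lemma le_opnorm m n (E E' : 'M[R]_(m, n)) :
  (forall j i, 0 <= E j i <= E' j i) -> opnorm E <= opnorm E'.
Proof.
move=> EE'; apply: ge_sup.
  exists (l2norm (map_mx (real_complex R) E *m 0)); exists 0 => //=.
  rewrite /l2norm big1 ?sqrtr0// => k _.
  by rewrite mxE Normc.normc0 expr0n.
move=> _ [x /= x1 <-]; rewrite (le_trans (l2norm_absE x EE'))//.
apply: opnorm_ub; rewrite (le_trans _ x1)// le_l2norm// => k.
by rewrite mxE normc_real ger0_norm ?normc_nneg.
Qed.

(** Homogeneity: division by the Euclidean norm [t] of [v] leads to the unit ball. The zero vector
    is treated apart. *)
Lemma opnorm_sumsq m n (E : 'M[R]_(m, n)) (v : 'I_n -> R) :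
  \sum_j (\sum_i E j i * v i) ^+ 2 <= opnorm E ^+ 2 * \sum_i v i ^+ 2.
Proof.
set s := \sum_i v i ^+ 2.
have s0 : 0 <= s by rewrite sumr_ge0// => i _; rewrite sqr_ge0.
have [s00|s_neq0] := eqVneq s 0.
  have v0 i : v i = 0.
    apply/eqP; rewrite -sqrf_eq0 eq_le sqr_ge0 andbT -s00 /s.
    by rewrite (bigD1 i)//= lerDl sumr_ge0// => j _; rewrite sqr_ge0.
  rewrite s00 mulr0 big1// => j _; rewrite big1 ?expr0n// => i _.
  by rewrite v0 mulr0.
pose t := Num.sqrt s.
have t0 : 0 < t by rewrite sqrtr_gt0 lt_neqAle eq_sym s_neq0.
have t2 : t ^+ 2 = s by rewrite sqr_sqrtr.
pose x : 'cV[C]_n := \col_i (v i / t)%:C%C.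
have x1 : l2norm x <= 1.
  rewrite /l2norm (_ : \sum_k _ = 1) ?sqrtr1//.
  under eq_bigr do rewrite mxE normc_real real_normK ?num_real// expr_div_n.
  by rewrite -mulr_suml t2 mulfV.
have := opnorm_ub E x1; rewrite -(ler_pXn2r (n := 2))//;
  rewrite ?nnegrE ?sqrtr_ge0 ?opnorm_ge0//.
rewrite l2norm_sqr => /(ler_wpM2r s0); apply: le_trans.
rewrite mulr_suml ler_sum// => j _.
rewrite mxE (_ : \sum_i _ = ((\sum_i E j i * v i) / t)%:C%C); last first.
  rewrite mulr_suml rmorph_sum; apply: eq_bigr => i _.
  by rewrite !mxE -rmorphM mulrA.
by rewrite normc_real real_normK ?num_real// expr_div_n t2 divfK.
Qed.

End Operator_norm.

(** * Taylor's remainder for the imaginary exponential *)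

Section Taylor.
Context {R : realType}.
Local Notation C := R[i].

(* [dexp n a b] is the [n]-th derivative at [0] of
   [Re ((a - i b) exp (- i t)) = a cos t - b sin t]. *)
Definition dexp (n : nat) (a b : R) : R :=
  complex.Re ((a -i* b)%C * (- 'i%C) ^+ n).

Lemma dexpS n a b : dexp n.+1 a b = dexp n (- b) a.
Proof.
rewrite /dexp exprS mulrA; congr (complex.Re (_ * _)).
by apply/eqP; rewrite eq_complex/=; apply/andP; split; apply/eqP; ring.
Qed.

(** Changing the sign of [b] is the reflection of [t] in [a cos t - b sin t], whence the sign of the
    [n]-th derivative. *)
Lemma dexpN n a b : dexp n a (- b) = (- 1) ^+ n * dexp n a b.
Proof.
elim: n a b => [|n IH] a b; first by rewrite /dexp !expr0 !mulr1 mul1r.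
have dexpNN u v : dexp n (- u) (- v) = - dexp n u v.
  by rewrite /dexp (_ : (- u -i* - v)%C = - (u -i* v)%C) ?mulNr ?cReN//.
have := dexpNN (- b) (- a); rewrite !opprK => ba.
by rewrite !dexpS opprK ba IH exprS; ring.
Qed.

Definition texp N a b : {poly R} := \poly_(n < N) (dexp n a b / n`!%:R).

Lemma deriv_texp N a b : deriv (texp N.+1 a b) = texp N (- b) a.
Proof.
apply/polyP => n; rewrite coef_deriv !coef_poly ltnS.
case: ifP => // _; last by rewrite mul0rn.
rewrite -dexpS factS natrM -mulr_natr invfM.
by field; rewrite addrC natr1 !pnatr_eq0 -lt0n fact_gt0.
Qed.

Lemma deriv_expn_fact N :
  deriv ((N.+1)`!%:R^-1 *: 'X^(N.+1)) = N`!%:R^-1 *: 'X^N :> {poly R}.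
Proof.
rewrite derivZ derivXn /= -['X^N *+ _]scaler_nat scalerA; congr (_ *: _).
by rewrite factS natrM invfM; field; rewrite addrC natr1 !pnatr_eq0 -lt0n fact_gt0.
Qed.

(** Differentiating the difference [G] of the two sides for [N.+1] gives the difference for [N] with
    [(a, b)] rotated to [(- b, a)]. By induction it is nonnegative, and [G 0 = 0]. An upper bound
    suffices, since the direction [(a, b)] is free. *)
Lemma taylor_expi_re_pos N (a b t : R) : a ^+ 2 + b ^+ 2 <= 1 -> 0 <= t ->
  a * cos t - b * sin t - (texp N a b).[t] <= t ^+ N / N`!%:R.
Proof.
elim: N a b t => [|N IH] a b t ab t0.
  rewrite /texp poly_def big_ord0 horner0 expr0 fact0 divr1 subr0.
  (* This square and that of [a cos t - b sin t] add up to [a ^+ 2 + b ^+ 2], which is at most 1. *)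
  have := sqr_ge0 (a * sin t + b * cos t); have := cos2Dsin2 t.
  move: (cos t) (sin t) => x y xy; nra.
pose G s := ((N.+1)`!%:R^-1 *: 'X^(N.+1) + texp N.+1 a b).[s]
             - a * cos s + b * sin s.
have dG (s : R) : is_derive s (1 : R) G ((N`!%:R^-1 *: 'X^N + texp N (- b) a).[s]
               + a * sin s + b * cos s).
  rewrite -deriv_expn_fact -deriv_texp -derivD.
  have dP : is_derive s (1 : R) (horner ((N.+1)`!%:R^-1 *: 'X^(N.+1) + texp N.+1 a b))
     (deriv ((N.+1)`!%:R^-1 *: 'X^(N.+1) + texp N.+1 a b)).[s].
    apply: DeriveDef; first exact: derivable_horner.
    by rewrite -derive1E derivE.
  rewrite /G; apply: is_derive_eq.
  by rewrite /GRing.scale/= mulrN opprK.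
have G0 : G 0 = 0.
  rewrite /G cos0 sin0 horner_coef0 coefD coefZ coefXn coef_poly/=.
  by rewrite /dexp expr0 !mulr1/= divr1 mulr0 add0r mulr0 addr0 subrr.
have : G 0 <= G t.
  apply: (@ger0_derive1_ndecry R G 0) => //.
  - move=> s; rewrite in_itv/= andbT => /ltW s0.
    rewrite derive1E (@derive_val _ _ _ _ _ _ _ (dG _)).
    have ba : (- b) ^+ 2 + a ^+ 2 <= 1 by rewrite sqrrN addrC.
    have := IH _ _ _ ba s0; rewrite !hornerE; lra.
  - apply: derivable_within_continuous => s _; exact: (@ex_derive _ _ _ _ _ _ _ (dG _)).
rewrite G0 /G !hornerE mulrC; lra.
Qed.

Lemma taylor_expi_re N (a b t : R) : a ^+ 2 + b ^+ 2 <= 1 ->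
  a * cos t - b * sin t - (texp N a b).[t] <= `|t| ^+ N / N`!%:R.
Proof.
move=> ab; have [t0|t0] := lerP 0 t.
  by rewrite ger0_norm; [exact: taylor_expi_re_pos|].
rewrite ltr0_norm//; move/ltW : t0 => t0.
have abN : a ^+ 2 + (- b) ^+ 2 <= 1 by rewrite sqrrN.
have tN : 0 <= - t by rewrite oppr_ge0.
apply: le_trans (taylor_expi_re_pos N abN tN).
rewrite cosN sinN mulrNN lerD2l lerN2 !horner_poly.
rewrite le_eqVlt; apply/orP; left; apply/eqP; apply: eq_bigr => n _.
have e : (- 1) ^+ n * (- 1) ^+ n = 1 :> R by rewrite -expr2 sqrr_sign.
rewrite dexpN [(- t) ^+ n]exprNn.
transitivity ((- 1) ^+ n * (- 1) ^+ n * (dexp n a b / n`!%:R * t ^+ n)).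
  by ring.
by rewrite e mul1r.
Qed.

(** Taylor polynomial in [u] of [exp(-2 pi i c u)]; it has [N] coefficients, hence is admissible in
    [Ebest] at order [N]. *)
Definition taylor_poly (c : R) N : {poly C} :=
  \poly_(n < N) ((- (2 * pi * c)%:C%C * 'i%C) ^+ n / n`!%:R).

(** For the unit vector [(a, b)] in the direction of the remainder [z], the modulus of [z] is the
    real part of [(a - i b) z], that is, the real remainder of [a cos t - b sin t]. Bounding real
    and imaginary parts separately would cost a factor [sqrt 2]. *)
Lemma normc_expi_taylor (c u : R) N :
  Normc.normc (expi (c * u) - (taylor_poly c N).[u%:C%C]) <=
  `|2 * pi * c * u| ^+ N / N`!%:R.
Proof.
set z : C := _ - _; pose t := 2 * pi * c * u.
have [->|z0] := eqVneq z 0.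
  by rewrite Normc.normc0 divr_ge0 ?ler0n// exprn_ge0.
have nz0 : Normc.normc z != 0 by apply: contra z0 => /eqP/Normc.eq0_normc ->.
pose a := complex.Re z / Normc.normc z; pose b := complex.Im z / Normc.normc z.
have ab : a ^+ 2 + b ^+ 2 = 1.
  rewrite /a /b !expr_div_n -mulrDl.
  by rewrite -normc_sqrE mulfV// expf_neq0.
have := taylor_expi_re N t (eq_ind_r (fun x => x <= 1) (lexx 1) ab).
apply: le_trans; rewrite le_eqVlt; apply/orP; left; apply/eqP.
have -> : Normc.normc z = complex.Re ((a -i* b)%C * z).
  have : Normc.normc z = a * complex.Re z + b * complex.Im z.
    rewrite /a /b mulrAC [X in _ + X]mulrAC -mulrDl -!expr2.
    by rewrite -normc_sqrE expr2 mulfK.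
  by move=> ->; rewrite cReM/=; ring.
rewrite /z mulrBr cReD cReN /expi (_ : 2 * pi * (c * u) = t); last first.
  by rewrite /t !mulrA.
congr (_ - _); first by rewrite /=; ring.
rewrite !horner_poly mulr_sumr cRe_sum; apply: eq_bigr => n _ /=.
rewrite /dexp.
have -> : (a -i* b)%C * ((- (2 * pi * c)%:C%C * 'i%C) ^+ n / n`!%:R * u%:C%C ^+ n)
   = (t ^+ n / n`!%:R)%:C%C * ((a -i* b)%C * (- 'i%C) ^+ n).
  rewrite [in RHS]rmorphM/= fmorphV/= rmorph_nat rmorphXn/= /t [in RHS]rmorphM/=.
  by rewrite !mulNr -!mulrN !exprMn; ring.
by rewrite cReM/= mul0r subr0 mulrAC [in RHS]mulrC mulrA.
Qed.

End Taylor.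

(** * Measurability of complex functions *)

Section Complex_measurable.
Context {R : realType} {d : measure_display} {T : measurableType d}.
Local Notation C := R[i].
Local Notation rmeasurable_fun f := (measurable_fun [set: T] (f : T -> R)).
Implicit Types (f g : T -> C) (h k : T -> R).

Definition complex_measurable f :=
  rmeasurable_fun (fun x => complex.Re (f x)) /\
  rmeasurable_fun (fun x => complex.Im (f x)).

Lemma measurable_sqrt : measurable_fun setT (@Num.sqrt R).
Proof.
by apply: continuous_measurable_fun; exact: sqrt_continuous.
Qed.

Lemma cmeasurableD f g : complex_measurable f -> complex_measurable g ->
  complex_measurable (fun x => f x + g x).
Proof.
move=> [f1 f2] [g1 g2]; split.
  by under eq_fun do rewrite cReD; exact: measurable_funD.
by under eq_fun do rewrite cImD; exact: measurable_funD.
Qed.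

Lemma cmeasurableM f g : complex_measurable f -> complex_measurable g ->
  complex_measurable (fun x => f x * g x).
Proof.
move=> [f1 f2] [g1 g2]; split.
  by under eq_fun do rewrite cReM; apply: measurable_funB;
    exact: measurable_funM.
by under eq_fun do rewrite cImM; apply: measurable_funD; exact: measurable_funM.
Qed.

Lemma cmeasurable_cst (a : C) : complex_measurable (fun=> a).
Proof. by split; exact: measurable_cst. Qed.

Lemma cmeasurable_sum (I : Type) (s : seq I) (F : I -> T -> C) :
  (forall i, complex_measurable (F i)) ->
  complex_measurable (fun x => \sum_(i <- s) F i x).
Proof.
move=> mF; elim: s => [|i s IH].
  by under eq_fun do rewrite big_nil; exact: cmeasurable_cst.
by under eq_fun do rewrite big_cons; exact: cmeasurableD.
Qed.

Lemma cmeasurableJ f : complex_measurable f -> complex_measurable (fun x => (f x)^*%C).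
Proof.
move=> [f1 f2]; split; first by under eq_fun do rewrite cReJ.
by under eq_fun do rewrite cImJ; exact: measurable_funN.
Qed.

Lemma cmeasurable_normc2 f : complex_measurable f ->
  rmeasurable_fun (fun x => Normc.normc (f x) ^+ 2).
Proof.
move=> [f1 f2]; under eq_fun do rewrite normc_sqrE.
by apply: measurable_funD; exact: measurable_funX.
Qed.

Lemma cmeasurable_normc f : complex_measurable f ->
  rmeasurable_fun (fun x => Normc.normc (f x)).
Proof.
move=> /cmeasurable_normc2 mf.
have -> : (fun x => Normc.normc (f x)) =
    Num.sqrt \o (fun x => Normc.normc (f x) ^+ 2).
  by apply/funext => x /=; rewrite sqrtr_sqr ger0_norm// normc_nneg.
exact: measurableT_comp measurable_sqrt mf.
Qed.

Lemma cmeasurable_real h : rmeasurable_fun h -> complex_measurable (fun x => (h x)%:C%C).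
Proof. by move=> mh; split => //=; exact: measurable_cst. Qed.

Lemma cmeasurable_expi h : rmeasurable_fun h -> complex_measurable (fun x => expi (h x)).
Proof.
move=> mh; have mk : rmeasurable_fun (fun x => 2 * pi * h x).
  exact: measurable_funM (measurable_cst _) mh.
split=> /=.
  apply: measurableT_comp mk.
  by apply: continuous_measurable_fun; exact: continuous_cos.
apply: measurable_funN; apply: measurableT_comp mk.
by apply: continuous_measurable_fun; exact: continuous_sin.
Qed.

Lemma cmeasurableX f n : complex_measurable f -> complex_measurable (fun x => f x ^+ n).
Proof.
move=> mf; elim: n => [|n IH].
  by under eq_fun do rewrite expr0; exact: cmeasurable_cst.
by under eq_fun do rewrite exprS; exact: cmeasurableM.
Qed.

Lemma cmeasurable_horner (p : {poly C}) f : complex_measurable f ->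
  complex_measurable (fun x => p.[f x]).
Proof.
move=> mf; under eq_fun do rewrite horner_coef.
apply: cmeasurable_sum => i; apply: cmeasurableM; first exact: cmeasurable_cst.
exact: cmeasurableX.
Qed.

End Complex_measurable.

(** * Integrals of complex functions for the completed Lebesgue measure *)

Section Complex_integral.
Context {R : realType}.
Local Notation C := R[i].
Local Notation mu := (@completed_lebesgue_measure R).
Local Notation lmeasurable_fun f := (measurable_fun [set: lebR R] (f : lebR R -> R)).
Local Notation integrable f := (mu.-integrable [set: lebR R] (EFin \o (f : lebR R -> R))).
Local Notation cmeasurable f := (@complex_measurable R _ (lebR R) f).
Implicit Types (f g : fn R) (h k : R -> R).

Lemma lmeasurable_id : lmeasurable_fun id.
Proof.
by move=> _ Y mY; rewrite setTI; apply: sub_caratheodory.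
Qed.

Lemma measurable_mem E : measurable (E : set (lebR R)) ->
  measurable_fun [set: lebR R] (fun x : lebR R => x \in E).
Proof.
move=> mE; apply: (measurable_fun_bool true); rewrite setTI.
by rewrite (_ : _ @^-1` _ = E)//; apply/seteqP;
  split=> x /=; [move=> /set_mem|move=> /mem_set].
Qed.

Lemma cmeasurable_proj (E : set R) f : measurable (E : set (lebR R)) ->
  cmeasurable f -> cmeasurable (Defs.proj E f).
Proof.
move=> mE [f1 f2].
have mb := measurable_mem mE.
split; rewrite /Defs.proj.
  rewrite (_ : (fun x => _) = fun x => if x \in E then complex.Re (f x) else 0).
    exact: measurable_fun_ifT.
  by apply/funext => x; case: ifP.
rewrite (_ : (fun x => _) = fun x => if x \in E then complex.Im (f x) else 0).
  exact: measurable_fun_ifT.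
by apply/funext => x; case: ifP.
Qed.

Lemma quadratic_discriminant (a b c : R) : 0 <= a ->
  (forall t, 0 <= t ^+ 2 * a - 2 * t * b + c) -> b ^+ 2 <= a * c.
Proof.
rewrite le_eqVlt => /orP[/eqP <-|a0] q.
  have [->|b0] := eqVneq b 0; first by rewrite expr0n mul0r.
  (* With [a = 0] and [b != 0] the expression is affine in [t], and at this point it equals -1. *)
  have := q ((c + 1) / (2 * b)); rewrite mulr0 add0r.
  have -> : 2 * ((c + 1) / (2 * b)) * b = c + 1 by field.
  lra.
have := q (b / a).
have -> : (b / a) ^+ 2 * a - 2 * (b / a) * b + c = (a * c - b ^+ 2) / a.
  by field; rewrite gt_eqF.
by rewrite pmulr_lge0 ?invr_gt0// subr_ge0.
Qed.

Lemma integrable_le h k : lmeasurable_fun h -> integrable k ->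
  (forall x, `|h x| <= k x) -> integrable h.
Proof.
move=> mh ik hk; apply: (le_integrable measurableT _ _ ik).
  by apply/measurable_EFinP; exact: mh.
by move=> x _; rewrite /= lee_fin (le_trans (hk x))// ler_norm.
Qed.

Lemma integrable_lmeasurable h : integrable h -> lmeasurable_fun h.
Proof. by move=> /measurable_int /measurable_EFinP. Qed.

(** The product is dominated by [h ^+ 2 + k ^+ 2]; the inequality is the discriminant condition for
    the nonnegative quadratic [t |-> int (t h - k)^2]. *)
Lemma Rcauchy_schwarz h k : lmeasurable_fun h -> lmeasurable_fun k ->
  integrable (fun x => h x ^+ 2) -> integrable (fun x => k x ^+ 2) ->
  integrable (fun x => h x * k x) /\
  (\int[mu]_x (h x * k x)) ^+ 2 <=
  (\int[mu]_x (h x ^+ 2)) * \int[mu]_x (k x ^+ 2).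
Proof.
move=> mh mk ih ik.
have ihk : integrable (fun x => h x * k x).
  apply: (@integrable_le _ (fun x => h x ^+ 2 + k x ^+ 2)).
  - exact: measurable_funM.
  - exact: (integrableD measurableT ih ik).
  - move=> x; rewrite ler_norml; apply/andP.
    by have := sqr_ge0 (h x + k x); have := sqr_ge0 (h x - k x); nra.
split=> //; apply: quadratic_discriminant.
  by apply: Rintegral_ge0 => x _; rewrite sqr_ge0.
move=> t.
have -> : t ^+ 2 * \int[mu]_x (h x ^+ 2) - 2 * t * \int[mu]_x (h x * k x)
    + \int[mu]_x (k x ^+ 2) = \int[mu]_x ((t * h x - k x) ^+ 2).
  rewrite -!RintegralZl// -RintegralB//; last 2 first.
  - exact: (integrableZl measurableT (t ^+ 2) ih).
  - exact: (integrableZl measurableT (2 * t) ihk).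
  rewrite -RintegralD//; last first.
    exact: (integrableB measurableT (integrableZl measurableT (t ^+ 2) ih)
              (integrableZl measurableT (2 * t) ihk)).
  by apply: eq_Rintegral => x _; ring.
by apply: Rintegral_ge0 => x _; rewrite sqr_ge0.
Qed.

Definition cintegrable f :=
  integrable (fun x => complex.Re (f x)) /\
  integrable (fun x => complex.Im (f x)).

Lemma normcRe_le (z : C) : `|complex.Re z| <= Normc.normc z.
Proof.
rewrite -(ler_pXn2r (n := 2))// ?nnegrE ?normc_nneg//.
by rewrite real_normK ?num_real// normc_sqrE lerDl sqr_ge0.
Qed.

Lemma normcIm_le (z : C) : `|complex.Im z| <= Normc.normc z.
Proof.
rewrite -(ler_pXn2r (n := 2))// ?nnegrE ?normc_nneg//.
by rewrite real_normK ?num_real// normc_sqrE lerDr sqr_ge0.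
Qed.

Lemma cintegrable_le f h : cmeasurable f -> integrable h ->
  (forall x, Normc.normc (f x) <= h x) -> cintegrable f.
Proof.
move=> [f1 f2] ih fh; split; apply: integrable_le ih _ => //= x.
  exact: le_trans (normcRe_le _) (fh x).
exact: le_trans (normcIm_le _) (fh x).
Qed.

Lemma cintegrable_measurable f : cintegrable f -> cmeasurable f.
Proof. by move=> [? ?]; split; exact: integrable_lmeasurable. Qed.

Lemma cintegrable_normc f : cintegrable f ->
  integrable (fun x => Normc.normc (f x)).
Proof.
move=> intf; have [f1 f2] := intf.
apply: (@integrable_le _ (fun x => `|complex.Re (f x)| + `|complex.Im (f x)|)).
- exact/cmeasurable_normc/cintegrable_measurable.
- exact: (integrableD measurableT (integrable_norm f1) (integrable_norm f2)).
- move=> x; rewrite ger0_norm ?normc_nneg//.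
  rewrite -(ler_pXn2r (n := 2))// ?nnegrE ?normc_nneg ?addr_ge0//.
  rewrite normc_sqrE sqrrD !real_normK ?num_real// -addrA lerD2l lerDr.
  by rewrite mulrn_wge0// mulr_ge0.
Qed.

Lemma cintegrableD f g : cintegrable f -> cintegrable g ->
  cintegrable (fun x => f x + g x).
Proof.
move=> [f1 f2] [g1 g2]; split.
  rewrite (_ : (fun x => _) = fun x => complex.Re (f x) + complex.Re (g x)).
    exact: (integrableD measurableT f1 g1).
  by apply/funext => x; rewrite cReD.
rewrite (_ : (fun x => _) = fun x => complex.Im (f x) + complex.Im (g x)).
  exact: (integrableD measurableT f2 g2).
by apply/funext => x; rewrite cImD.
Qed.

Lemma cintegrableZ (a : C) f : cintegrable f -> cintegrable (fun x => a * f x).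
Proof.
move=> intf; apply: (@cintegrable_le _ (fun x => Normc.normc a * Normc.normc (f x))).
- apply: cmeasurableM; first exact: cmeasurable_cst.
  exact: cintegrable_measurable.
- exact: (integrableZl measurableT (Normc.normc a) (cintegrable_normc intf)).
- by move=> x; rewrite Normc.normcM.
Qed.

Lemma cintegrable0 : cintegrable (fun=> 0).
Proof. by split; exact: (integrable0 mu). Qed.

Lemma cintegrable_sum (I : Type) (s : seq I) (F : I -> fn R) :
  (forall i, cintegrable (F i)) -> cintegrable (fun x => \sum_(i <- s) F i x).
Proof.
move=> mF; elim: s => [|i s IH].
  by under eq_fun do rewrite big_nil; exact: cintegrable0.
by under eq_fun do rewrite big_cons; exact: cintegrableD.
Qed.

Lemma complex_ext (z w : C) :
  complex.Re z = complex.Re w -> complex.Im z = complex.Im w -> z = w.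
Proof. by case: z w => [? ?] [? ?] /= -> ->. Qed.

Lemma eq_cintegral f g : f =1 g -> cintegral f = cintegral g.
Proof. by move=> /funext ->. Qed.

Lemma cintegralD f g : cintegrable f -> cintegrable g ->
  cintegral (fun x => f x + g x) = cintegral f + cintegral g.
Proof.
move=> [f1 f2] [g1 g2]; apply: complex_ext; rewrite ?cReD ?cImD /=.
  by rewrite -RintegralD//; apply: eq_Rintegral => x _; rewrite cReD.
by rewrite -RintegralD//; apply: eq_Rintegral => x _; rewrite cImD.
Qed.

Lemma cintegralZ (a : C) f : cintegrable f ->
  cintegral (fun x => a * f x) = a * cintegral f.
Proof.
move=> [f1 f2]; apply: complex_ext; rewrite ?cReM ?cImM /=.
  rewrite -!RintegralZl// -RintegralB//.
  - by apply: eq_Rintegral => x _; rewrite cReM.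
  - exact: (integrableZl measurableT _ f1).
  - exact: (integrableZl measurableT _ f2).
rewrite -!RintegralZl// -RintegralD//.
- by apply: eq_Rintegral => x _; rewrite cImM.
- exact: (integrableZl measurableT _ f2).
- exact: (integrableZl measurableT _ f1).
Qed.

Lemma cintegral0 : cintegral (fun=> 0) = 0 :> C.
Proof. by rewrite /cintegral /= Rintegral_cst// mul0r. Qed.

Lemma cintegral_sum (I : Type) (s : seq I) (F : I -> fn R) :
  (forall i, cintegrable (F i)) ->
  cintegral (fun x => \sum_(i <- s) F i x) = \sum_(i <- s) cintegral (F i).
Proof.
move=> iF; elim: s => [|i s IH].
  by rewrite big_nil -[RHS]cintegral0; apply: eq_cintegral => x; rewrite big_nil.
rewrite big_cons -IH -cintegralD//; last exact: cintegrable_sum.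
by apply: eq_cintegral => x; rewrite big_cons.
Qed.

Lemma cintegralJ f : cintegrable f ->
  cintegral (fun x => (f x)^*%C) = (cintegral f)^*%C.
Proof.
move=> [f1 f2]; apply: complex_ext; rewrite ?cReJ ?cImJ /=.
  by apply: eq_Rintegral => x _; rewrite cReJ.
rewrite -mulN1r -RintegralZl//; apply: eq_Rintegral => x _.
by rewrite cImJ mulN1r.
Qed.

Lemma ae_imply2 (P Q S : R -> Prop) : (forall x, P x -> Q x -> S x) ->
  {ae mu, forall x, P x} -> {ae mu, forall x, Q x} -> {ae mu, forall x, S x}.
Proof. by have F := ae_filter_ringOfSetsType mu; exact: filterS2. Qed.

Lemma ae_imply (P Q : R -> Prop) : (forall x, P x -> Q x) ->
  {ae mu, forall x, P x} -> {ae mu, forall x, Q x}.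
Proof. by have F := ae_filter_ringOfSetsType mu; exact: filterS. Qed.

Lemma ae_eq_Rintegral (D : set (lebR R)) h k : measurable D ->
  lmeasurable_fun h -> lmeasurable_fun k ->
  {ae mu, forall x, h x = k x} -> \int[mu]_(x in D) h x = \int[mu]_(x in D) k x.
Proof.
move=> mD mh mk hk; congr fine; apply: (ae_eq_integral _ _ mD).
- by apply: measurable_funTS; exact/measurable_EFinP.
- by apply: measurable_funTS; exact/measurable_EFinP.
- by apply: ae_imply hk => x -> _.
Qed.

Lemma ae_eq_cintegral f g : cmeasurable f -> cmeasurable g ->
  ae_eq_fn f g -> cintegral f = cintegral g.
Proof.
move=> [f1 f2] [g1 g2] fg; apply: complex_ext => /=; apply: ae_eq_Rintegral => //;
  by apply: ae_imply fg => x ->.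
Qed.

(* Rotating the integral onto the positive real axis reduces the bound to
   [Re z <= |z|]. *)
Lemma normc_cintegral_le f : cintegrable f ->
  Normc.normc (cintegral f) <= \int[mu]_x Normc.normc (f x).
Proof.
move=> intf; set z := cintegral f.
have [->|z0] := eqVneq z 0.
  by rewrite Normc.normc0; apply: Rintegral_ge0 => x _; rewrite normc_nneg.
have nz0 : Normc.normc z != 0 by apply: contra z0 => /eqP/Normc.eq0_normc ->.
pose u : C := (z / (Normc.normc z)%:C%C)^*%C.
have nu : Normc.normc u = 1.
  have -> : Normc.normc u = Normc.normc (z / (Normc.normc z)%:C%C).
    by rewrite /u; case: (_ / _) => a b /=; rewrite sqrrN.
  rewrite Normc.normcM Normc.normcV normc_real ger0_norm ?normc_nneg//.
  by rewrite mulfV.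
have -> : Normc.normc z = complex.Re (cintegral (fun x => u * f x)).
  rewrite cintegralZ// -/z.
  have -> : u * z = (Normc.normc z)%:C%C.
    have zz : z * z^*%C = ((Normc.normc z) ^+ 2)%:C%C.
      by rewrite normc_sqrE; case: (z) => a b /=;
        apply: complex_ext; rewrite ?cReM ?cImM/=; ring.
    have -> : u = z^*%C * (Normc.normc z)^-1%:C%C.
      rewrite /u -fmorphV; case: (z) => a b; move: (_^-1) => r.
      by apply: complex_ext; rewrite ?cReJ ?cImJ ?cReM ?cImM /=; ring.
    by rewrite mulrAC [_ * z]mulrC zz -rmorphM expr2 mulfK.
  by [].
have [i1 i2] := cintegrableZ u intf.
rewrite /=; apply: le_Rintegral => //; first exact: cintegrable_normc.
move=> x _; rewrite (le_trans (ler_norm _))// (le_trans (normcRe_le _))//.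
by rewrite Normc.normcM nu mul1r.
Qed.

End Complex_integral.

(** * Square-integrable functions and their inner product *)

Section L2_functions.
Context {R : realType}.
Local Notation C := R[i].
Local Notation mu := (@completed_lebesgue_measure R).
Local Notation integrable f := (mu.-integrable [set: lebR R] (EFin \o (f : lebR R -> R))).
Local Notation cmeasurable f := (@complex_measurable R _ (lebR R) f).
Implicit Types (f g : fn R).

Definition sqnorm f : R := \int[mu]_x (Normc.normc (f x) ^+ 2).

Lemma sqnorm_ge0 f : 0 <= sqnorm f.
Proof. by apply: Rintegral_ge0 => x _; rewrite sqr_ge0. Qed.

Lemma L2P f : L2 f <->
  cmeasurable f /\ integrable (fun x => Normc.normc (f x) ^+ 2).
Proof.
split=> [[f1 f2 foo]|[[f1 f2] /integrableP[_ foo]]].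
  have mf : cmeasurable f by [].
  split=> //; apply/integrableP; split.
    by apply/measurable_EFinP; exact: cmeasurable_normc2 mf.
  apply: le_lt_trans foo; rewrite le_eqVlt; apply/orP; left; apply/eqP.
  by apply: eq_integral => x _ /=; rewrite ger0_norm// sqr_ge0.
split=> //; apply: le_lt_trans foo; rewrite le_eqVlt; apply/orP; left; apply/eqP.
by apply: eq_integral => x _ /=; rewrite ger0_norm// sqr_ge0.
Qed.

Lemma L2_measurable f : L2 f -> cmeasurable f.
Proof. by move=> /L2P[]. Qed.

Lemma L2_integrable f : L2 f -> integrable (fun x => Normc.normc (f x) ^+ 2).
Proof. by move=> /L2P[]. Qed.

Lemma L2_sqnormE f : L2 f ->
  (\int[mu]_x ((Normc.normc (f x)) ^+ 2)%:E = (sqnorm f)%:E)%E.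
Proof.
by move=> /L2_integrable i; rewrite fineK//; exact: integrable_fin_num i.
Qed.

Lemma L2_le f g : cmeasurable f -> L2 g ->
  (forall x, Normc.normc (f x) <= Normc.normc (g x)) -> L2 f.
Proof.
move=> mf L2g fg; apply/L2P; split=> //.
apply: (integrable_le _ (L2_integrable L2g)).
  exact: cmeasurable_normc2 mf.
by move=> x; rewrite ger0_norm ?sqr_ge0// lerXn2r ?nnegrE ?normc_nneg.
Qed.

Lemma L2Z (a : C) f : L2 f -> L2 (fun x => a * f x).
Proof.
move=> L2f; apply/L2P; split.
  by apply: cmeasurableM; [exact: cmeasurable_cst|exact: L2_measurable].
rewrite (_ : (fun x => _) =
    fun x => Normc.normc a ^+ 2 * Normc.normc (f x) ^+ 2); last first.
  by apply/funext => x; rewrite Normc.normcM exprMn.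
exact: (integrableZl measurableT _ (L2_integrable L2f)).
Qed.

Lemma L2D f g : L2 f -> L2 g -> L2 (fun x => f x + g x).
Proof.
move=> L2f L2g; have mfg : cmeasurable (fun x => f x + g x).
  by apply: cmeasurableD; exact: L2_measurable.
apply/L2P; split=> //.
apply: (@integrable_le _ _ (fun x => 2 * Normc.normc (f x) ^+ 2 +
                                 2 * Normc.normc (g x) ^+ 2)).
- exact: cmeasurable_normc2 mfg.
- exact: (integrableD measurableT
    (integrableZl measurableT _ (L2_integrable L2f))
    (integrableZl measurableT _ (L2_integrable L2g))).
- move=> x; rewrite ger0_norm ?sqr_ge0//.
  apply: (@le_trans _ _ ((Normc.normc (f x) + Normc.normc (g x)) ^+ 2)).
    by rewrite lerXn2r ?nnegrE ?addr_ge0 ?normc_nneg ?le_normcD.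
  by have := sqr_ge0 (Normc.normc (f x) - Normc.normc (g x)); nra.
Qed.

Lemma L2_0 : L2 (fun=> 0 : C).
Proof.
apply/L2P; split; first exact: cmeasurable_cst.
rewrite (_ : (fun x => _) = fun=> 0); first exact: (integrable0 mu).
by apply/funext => x; rewrite Normc.normc0 expr0n.
Qed.

Lemma L2_sum (I : Type) (s : seq I) (F : I -> fn R) :
  (forall i, L2 (F i)) -> L2 (fun x => \sum_(i <- s) F i x).
Proof.
move=> LF; elim: s => [|i s IH].
  by under eq_fun do rewrite big_nil; exact: L2_0.
by under eq_fun do rewrite big_cons; exact: L2D.
Qed.

Lemma L2_lincomb n (a : 'I_n -> C) (f : 'I_n -> fn R) :
  (forall k, L2 (f k)) -> L2 (lincomb a f).
Proof. by move=> Lf; apply: L2_sum => k; exact: L2Z. Qed.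

Lemma normc_conj (z : C) : Normc.normc z^*%C = Normc.normc z.
Proof. by case: z => a b /=; rewrite sqrrN. Qed.

Lemma L2J f : L2 f -> L2 (fun x => (f x)^*%C).
Proof.
move=> Lf; apply: (L2_le _ Lf); first exact/cmeasurableJ/L2_measurable.
by move=> x; rewrite normc_conj.
Qed.

Lemma normc_proj (E : set R) f x : Normc.normc (Defs.proj E f x) <= Normc.normc (f x).
Proof. by rewrite /Defs.proj; case: ifP; rewrite ?Normc.normc0 ?normc_nneg. Qed.

Lemma L2_proj (E : set R) f : measurable (E : set (lebR R)) ->
  L2 f -> L2 (Defs.proj E f).
Proof.
move=> mE Lf; apply: (L2_le _ Lf); last exact: normc_proj.
exact/cmeasurable_proj/L2_measurable.
Qed.

Lemma normc_proj2 (E : set R) f :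
  (fun x => Normc.normc (Defs.proj E f x) ^+ 2) =
  (fun x => Normc.normc (f x) ^+ 2) \_ E.
Proof.
apply/funext => x; rewrite /Defs.proj patchE; case: ifP => // _.
by rewrite Normc.normc0 expr0n.
Qed.

Lemma sqnorm_proj (E : set R) f :
  sqnorm (Defs.proj E f) = \int[mu]_(x in (E : set (lebR R))) (Normc.normc (f x) ^+ 2).
Proof. by rewrite /sqnorm normc_proj2 -Rintegral_mkcond. Qed.

Lemma L2_bounded_proj (E : set R) f (M : R) : measurable (E : set (lebR R)) ->
  (mu E < +oo)%E -> cmeasurable f ->
  (forall x, E x -> Normc.normc (f x) <= M) -> L2 (Defs.proj E f).
Proof.
move=> mE Eoo mf fM; apply/L2P; split; first exact: cmeasurable_proj.
apply: (@integrable_le _ _ (cst (M ^+ 2) \_ E)).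
- exact: cmeasurable_normc2 (cmeasurable_proj mE mf).
- rewrite (_ : EFin \o _ = (EFin \o cst (M ^+ 2)) \_ E); last first.
    by rewrite restrict_EFin.
  apply/(integrable_mkcond _ mE).1; apply: measurable_bounded_integrable => //.
  exact: bounded_cst.
- move=> x; rewrite ger0_norm ?sqr_ge0// /Defs.proj patchE.
  case: ifPn => [/set_mem Ex|_]; last by rewrite Normc.normc0 expr0n.
  have := fM _ Ex => le; rewrite lerXn2r ?nnegrE ?normc_nneg//.
  exact: le_trans (normc_nneg _) le.
Qed.

Lemma L2M f g : L2 f -> L2 g -> cintegrable (fun x => f x * g x).
Proof.
move=> Lf Lg.
have mf := L2_measurable Lf; have mg := L2_measurable Lg.
have [ifg _] := Rcauchy_schwarz (cmeasurable_normc mf) (cmeasurable_normc mg)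
  (L2_integrable Lf) (L2_integrable Lg).
apply: (cintegrable_le _ ifg); first exact: cmeasurableM.
by move=> x; rewrite Normc.normcM.
Qed.

Lemma cauchy_schwarz f g : L2 f -> L2 g ->
  Normc.normc (cintegral (fun x => f x * g x)) ^+ 2 <= sqnorm f * sqnorm g.
Proof.
move=> Lf Lg.
have mf := L2_measurable Lf; have mg := L2_measurable Lg.
have [ifg cs] := Rcauchy_schwarz (cmeasurable_normc mf) (cmeasurable_normc mg)
  (L2_integrable Lf) (L2_integrable Lg).
apply: le_trans cs; rewrite lerXn2r ?nnegrE ?normc_nneg//.
  by apply: Rintegral_ge0 => x _; rewrite mulr_ge0 ?normc_nneg.
apply: le_trans (normc_cintegral_le (L2M Lf Lg)) _.
rewrite le_eqVlt; apply/orP; left; apply/eqP.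
by apply: eq_Rintegral => x _; rewrite Normc.normcM.
Qed.

Lemma inner_cintegrable f g : L2 f -> L2 g ->
  cintegrable (fun x => f x * (g x)^*%C).
Proof. by move=> Lf Lg; exact: L2M Lf (L2J Lg). Qed.

Lemma inner_self f : L2 f -> inner f f = (sqnorm f)%:C%C.
Proof.
move=> Lf; apply: complex_ext => /=.
  apply: eq_Rintegral => x _; rewrite cReM cReJ cImJ normc_sqrE; ring.
rewrite -[RHS](mul0r (fine (mu setT))) -Rintegral_cst//.
by apply: eq_Rintegral => x _; rewrite cImM cReJ cImJ; ring.
Qed.

Lemma innerJ f g : L2 f -> L2 g -> inner g f = (inner f g)^*%C.
Proof.
move=> Lf Lg; rewrite /inner -cintegralJ; last exact: inner_cintegrable.
apply: eq_cintegral => x; case: (f x) => a b; case: (g x) => a' b'.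
by apply: complex_ext => /=; ring.
Qed.

Lemma ae_inner f f' g g' : L2 f -> L2 f' -> L2 g -> L2 g' ->
  ae_eq_fn f f' -> ae_eq_fn g g' -> inner f g = inner f' g'.
Proof.
move=> Lf Lf' Lg Lg' ff' gg'; apply: ae_eq_cintegral.
- exact/cintegrable_measurable/inner_cintegrable.
- exact/cintegrable_measurable/inner_cintegrable.
- by apply: ae_imply2 ff' gg' => x -> ->.
Qed.

Lemma inner_lincombl n (a : 'I_n -> C) (f : 'I_n -> fn R) g :
  (forall k, L2 (f k)) -> L2 g ->
  inner (lincomb a f) g = \sum_k a k * inner (f k) g.
Proof.
move=> Lf Lg; rewrite /inner /lincomb.
under [RHS]eq_bigr => k _ do rewrite -(cintegralZ _ (inner_cintegrable (Lf k) Lg)).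
rewrite -cintegral_sum; last first.
  by move=> k; apply/cintegrableZ/inner_cintegrable.
apply: eq_cintegral => x; rewrite mulr_suml.
by apply: eq_bigr => k _; rewrite mulrA.
Qed.

Lemma inner_lincombr n (a : 'I_n -> C) (f : 'I_n -> fn R) g :
  (forall k, L2 (f k)) -> L2 g ->
  inner g (lincomb a f) = \sum_k (a k)^*%C * inner g (f k).
Proof.
move=> Lf Lg; rewrite (innerJ (L2_lincomb _ Lf) Lg) inner_lincombl//.
rewrite cJ_sum; apply: eq_bigr => k _.
by rewrite cJM -innerJ.
Qed.

Lemma sqnorm_eq0 f : L2 f -> sqnorm f = 0 -> ae_eq_fn f (fun=> 0).
Proof.
move=> Lf f0.
have mf := cmeasurable_normc2 (L2_measurable Lf).
have : (\int[mu]_x `|(Normc.normc (f x) ^+ 2)%:E| = 0)%E.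
  transitivity (sqnorm f)%:E; last by rewrite f0.
  rewrite -(L2_sqnormE Lf).
  by apply: eq_integral => x _; rewrite gee0_abs// lee_fin sqr_ge0.
move/measurable_EFinP : mf => mf /(ae_eq_integral_abs mu measurableT mf).
apply: ae_imply => x /(_ I)/= [e].
by apply: Normc.eq0_normc; apply/eqP; rewrite -sqrf_eq0 e.
Qed.

(** At each point at most one of the projections is nonzero, the pieces being disjoint. *)
Lemma sum_sqnorm_proj n (P : 'I_n -> set R) f :
  (forall i, measurable (P i : set (lebR R))) -> trivIset setT P -> L2 f ->
  \sum_i sqnorm (Defs.proj (P i) f) <= sqnorm f.
Proof.
move=> mP tP Lf.
have mPf i : measurable_fun [set: lebR R]
    (fun x => (Normc.normc (Defs.proj (P i) f x) ^+ 2)%:E).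
  by apply/measurable_EFinP; exact: cmeasurable_normc2
    (cmeasurable_proj (mP i) (L2_measurable Lf)).
have Pf0 i (x : lebR R) : (0 <= (Normc.normc (Defs.proj (P i) f x) ^+ 2)%:E)%E.
  by rewrite lee_fin sqr_ge0.
rewrite -lee_fin -sumEFin.
under eq_bigr => i _ do rewrite -(L2_sqnormE (L2_proj (mP i) Lf)).
rewrite -(L2_sqnormE Lf).
have <- := @ge0_integral_sum _ _ _ mu _ measurableT _ _ mPf (fun i x _ => Pf0 i x)
  (index_enum 'I_n).
apply: (ge0_le_integral mu measurableT).
- by move=> x _; apply: sume_ge0 => i _; exact: Pf0.
- exact: emeasurable_sum.
- by apply/measurable_EFinP; exact: cmeasurable_normc2 (L2_measurable Lf).
move=> x _; rewrite sumEFin lee_fin.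
have [[i Pix]|nP] := pselect (exists i, P i x).
  rewrite (bigD1 i)//= big1 ?addr0; last first.
    move=> j ji; rewrite /Defs.proj; case: ifPn => [/set_mem Pjx|_].
      by move/trivIsetP : tP => /(_ j i I I ji)/seteqP[/(_ x)[]].
    by rewrite Normc.normc0 expr0n.
  by rewrite lerXn2r ?nnegrE ?normc_nneg// normc_proj.
rewrite big1 ?sqr_ge0// => i _; rewrite /Defs.proj; case: ifPn => [/set_mem Pix|_].
  by exfalso; apply: nP; exists i.
by rewrite Normc.normc0 expr0n.
Qed.

End L2_functions.

(** * Scaling of the Lebesgue measure *)

Section Dilation.
Context {R : realType}.
Local Notation mu := (@completed_lebesgue_measure R).
Local Notation nu := ((@wlength R idfun)^*)%mu.
Implicit Types (X Y : set R) (c : R).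

Lemma dilateE c X : c != 0 -> dilate c X = (fun y => c^-1 * y) @^-1` X.
Proof.
move=> c0; apply/seteqP; split=> [_ [x Xx <-]|y Xy] /=; first by rewrite mulKf.
by exists (c^-1 * y) => //; rewrite mulVKf.
Qed.

Lemma dilateK c X : c != 0 -> dilate c^-1 (dilate c X) = X.
Proof.
move=> c0; rewrite !dilateE ?invr_eq0//; apply/seteqP.
by split=> x /=; rewrite invrK mulKf.
Qed.

Lemma wlength_dilate c X : 0 < c -> ocitv X ->
  ocitv (dilate c X) /\ wlength idfun (dilate c X) = (c%:E * wlength idfun X)%E.
Proof.
move=> c0 /ocitvP[->|[[a b] /= ab ->]].
  by rewrite /dilate image_set0 wlength0 mule0; split=> //; exact: ocitv0.
have -> : dilate c `]a, b]%classic = `]c * a, c * b]%classic.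
  rewrite dilateE ?gt_eqF//; apply/seteqP; split=> x /=; rewrite !in_itv/=.
    by rewrite ltr_pdivlMl// ler_pdivrMl.
  by rewrite ltr_pdivlMl// ler_pdivrMl.
split; first exact: is_ocitv.
rewrite !wlength_itv_bnd ?(ltW ab)//; first by rewrite -EFinM mulrBr.
by rewrite ler_pM2l// ltW.
Qed.

(** A cover of [X] by half-open intervals dilates to a cover whose lengths are multiplied by [c].
    The same inequality for [c^-1] gives the converse. Stated for the outer measure it holds for
    every set, as Carathéodory's criterion requires. *)
Lemma mu_ext_dilate_le c X : 0 < c -> (nu (dilate c X) <= c%:E * nu X)%E.
Proof.
move=> c0; rewrite -lee_pdivrMl//.
apply: le_ereal_inf_tmp => _ [F [mF XF] <-].
rewrite lee_pdivrMl// -nneseriesZl//.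
have -> : (\sum_(0 <= k <oo) (c%:E * wlength idfun (F k)) =
    \sum_(0 <= k <oo) wlength idfun (dilate c (F k)))%E.
  by apply: eq_eseriesr => k _; rewrite (wlength_dilate c0 (mF k)).2.
apply: ereal_inf_lbound; exists (fun k => dilate c (F k)) => //; split.
  by move=> k; exact: (wlength_dilate c0 (mF k)).1.
move=> _ [x /XF [k _ Fkx] <-]; exists k => //.
by exists x.
Qed.

Lemma mu_ext_dilate c X : 0 < c -> nu (dilate c X) = (c%:E * nu X)%E.
Proof.
move=> c0; apply/eqP; rewrite eq_le mu_ext_dilate_le//=.
rewrite -lee_pdivlMl// -{1}(dilateK X (lt0r_neq0 c0)).
by apply: mu_ext_dilate_le; rewrite invr_gt0.
Qed.

(** Continuity of the multiplication only handles preimages of Borel sets, whereas the sigma-algebra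
    is the completed one. Its sets are those satisfying Carathéodory's criterion, and this is
    transported by the scaling of the outer measure. *)
Lemma measurable_dilate c X : 0 < c -> measurable (X : set (lebR R)) ->
  measurable (dilate c X : set (lebR R)).
Proof.
move=> c0 mX.
have cX : caratheodory_measurable nu X by exact: mX.
suff : caratheodory_measurable nu (dilate c X) by [].
move=> Y; have c1 : c != 0 by rewrite gt_eqF.
pose Y' := dilate c^-1 Y.
have YE : Y = dilate c Y' by rewrite -[in LHS](dilateK (c := c^-1) Y) ?invr_eq0// invrK.
rewrite YE !(dilateE _ c1) preimage_setC -!preimage_setI -!(dilateE _ c1).
by rewrite !(mu_ext_dilate _ c0) (cX Y') ge0_muleDr// outer_measure_ge0.
Qed.

Lemma lebesgue_dilate c X : 0 < c -> mu (dilate c X) = (c%:E * mu X)%E.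
Proof. by move=> c0; exact: mu_ext_dilate. Qed.

Lemma measurable_mull c : 0 < c ->
  measurable_fun [set: lebR R] ((fun y => c * y) : lebR R -> lebR R).
Proof.
move=> c0 _ Y mY; rewrite setTI -[c]invrK -dilateE ?gt_eqF ?invr_gt0//.
by apply: measurable_dilate; rewrite ?invr_gt0.
Qed.

(** Change of variables: the image of the Lebesgue measure under [y |-> c y] is [c^-1] times the
    Lebesgue measure, called [m] below. *)
Lemma ge0_integral_dilate c (B : set R) (h : R -> \bar R) : 0 < c ->
  measurable (B : set (lebR R)) ->
  measurable_fun [set: lebR R] (h : lebR R -> \bar R) -> (forall x, 0 <= h x)%E ->
  (\int[mu]_(x in dilate c B) h x = c%:E * \int[mu]_(x in B) h (c * x)%R)%E.
Proof.
move=> c0 mB mh h0; have c1 : c != 0 by rewrite gt_eqF.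
have mD := measurable_dilate c0 mB.
have BE : B = (fun y => c * y) @^-1` (dilate c B).
  by rewrite dilateE//; apply/seteqP; split=> x /=; rewrite mulKf.
have ic0 : 0 <= c^-1 by rewrite invr_ge0 ltW.
pose m : {measure set (lebR R) -> \bar R} := mscale (NngNum ic0) mu.
have := @ge0_integral_pushforward _ _ _ _ _ _ (measurable_mull c0) mu
  (dilate c B) h mD (measurable_funTS mh) (fun y _ => h0 y).
rewrite -BE => /= <-.
transitivity (c%:E * \int[m]_(x in dilate c B) h x)%E.
  rewrite (ge0_integral_mscale mu mD _ (measurable_funTS mh) (fun y _ => h0 y)).
  by rewrite /= muleA -EFinM mulfV// mul1e.
congr (_ * _)%E; symmetry; apply: eq_measure_integral => [|mphi Y mY _].
  exact: measurable_mull.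
transitivity (mu (dilate c^-1 Y)); first by rewrite dilateE ?invr_eq0// invrK.
by apply: lebesgue_dilate; rewrite invr_gt0.
Qed.

End Dilation.

(** * Parameter integrals and the exchange of the order of integration *)

Section Parametric_integral.
Context {R : realType}.
Local Notation mu := (@completed_lebesgue_measure R).
Local Notation lmeasurable_fun f := (measurable_fun [set: lebR R] (f : lebR R -> R)).
Local Notation integrable f := (mu.-integrable [set: lebR R] (EFin \o (f : lebR R -> R))).
Local Notation lmeasurable2 f :=
  (measurable_fun [set: lebR R * lebR R] (f : lebR R * lebR R -> R)).
Implicit Types (A B : set R) (h : R * R -> R).

Lemma lmeasurable_fst : lmeasurable2 fst.
Proof. exact: (measurableT_comp lmeasurable_id measurable_fst). Qed.

Lemma lmeasurable_snd : lmeasurable2 snd.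
Proof. exact: (measurableT_comp lmeasurable_id measurable_snd). Qed.

(** The integrals of the positive and the negative part are measurable by Tonelli, and so are
    extended subtraction and [fine]. The statement therefore covers parameters at which the integral
    diverges. *)
Lemma lmeasurable_Rintegrall h : lmeasurable2 h ->
  lmeasurable_fun (fun y => \int[mu]_x h (x, y)).
Proof.
move=> mh; have mEh : measurable_fun [set: lebR R * lebR R] (EFin \o h).
  exact/measurable_EFinP.
rewrite /Rintegral.
apply: (measurableT_comp (fine_measurable measurableT)).
have E y : (\int[mu]_x (h (x, y))%:E =
    fubini_G mu (EFin \o h)^\+ y - fubini_G mu (EFin \o h)^\- y)%E.
  rewrite /fubini_G [LHS](integralE mu setT (fun x => (h (x, y))%:E)).
  by congr (_ - _)%E; apply: eq_integral => x _; rewrite ?funeposE ?funenegE.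
under eq_fun do rewrite E.
apply: emeasurable_funB.
  by apply: measurable_fun_fubini_tonelli_G => //; exact: measurable_funepos.
by apply: measurable_fun_fubini_tonelli_G => //; exact: measurable_funeneg.
Qed.

Lemma lmeasurable_swap h : lmeasurable2 h -> lmeasurable2 (fun z => h (z.2, z.1)).
Proof.
move=> mh.
exact: (measurableT_comp mh (measurable_fun_pair measurable_snd measurable_fst)).
Qed.

Lemma lmeasurable_Rintegralr h : lmeasurable2 h ->
  lmeasurable_fun (fun x => \int[mu]_y h (x, y)).
Proof. by move=> /lmeasurable_swap/lmeasurable_Rintegrall. Qed.

Lemma lmeasurable_pair1 h y : lmeasurable2 h -> lmeasurable_fun (fun x => h (x, y)).
Proof. exact: (@measurable_fun_pair1 _ _ _ (lebR R) (lebR R) _ h y). Qed.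

Lemma lmeasurable_pair2 h x : lmeasurable2 h -> lmeasurable_fun (fun y => h (x, y)).
Proof. exact: (@measurable_fun_pair2 _ _ _ (lebR R) (lebR R) _ h x). Qed.

Lemma integrable_patch_cst A (M : R) : measurable (A : set (lebR R)) ->
  (mu A < +oo)%E -> integrable (fun x => if x \in A then M else 0).
Proof.
move=> mA Aoo.
rewrite (_ : EFin \o _ = (EFin \o cst M) \_ A); last first.
  by rewrite restrict_EFin.
apply/(integrable_mkcond _ mA).1; apply: (measurable_bounded_integrable mA Aoo).
  exact: measurable_cst.
exact: bounded_cst.
Qed.

Section Bounded_kernel.
Variables (A B : set R) (h : R * R -> R) (M : R).
Hypotheses (mA : measurable (A : set (lebR R))) (Aoo : (mu A < +oo)%E)
  (mB : measurable (B : set (lebR R))) (Boo : (mu B < +oo)%E).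
Hypotheses (mh : lmeasurable2 h) (h0 : forall z, 0 <= h z)
  (hM : forall x y, A x -> B y -> h (x, y) <= M).

(** Cutting [h] off outside the rectangle allows Tonelli's theorem to be used on the whole plane. *)
Let k z := if (z.1 \in A) && (z.2 \in B) then h z else 0.

Let mk : lmeasurable2 k.
Proof.
apply: measurable_fun_ifT => //; apply: measurable_and.
  exact: (measurableT_comp (measurable_mem mA) measurable_fst).
exact: (measurableT_comp (measurable_mem mB) measurable_snd).
Qed.

Let k0 z : 0 <= k z.
Proof. by rewrite /k; case: ifP. Qed.

Let ikr x : integrable (fun y => k (x, y)).
Proof.
apply: (integrable_le (lmeasurable_pair2 x mk) (integrable_patch_cst `|M| mB Boo)).
move=> y; rewrite ger0_norm// /k/=.
case: (boolP (x \in A)) => [/set_mem Ax|_]/=; last by case: ifP.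
case: ifP => [/set_mem By|//].
exact: le_trans (hM Ax By) (ler_norm _).
Qed.

Let ikl y : integrable (fun x => k (x, y)).
Proof.
apply: (integrable_le (lmeasurable_pair1 y mk) (integrable_patch_cst `|M| mA Aoo)).
move=> x; rewrite ger0_norm// /k/=.
case: ifP => [/andP[/set_mem Ax /set_mem By]|]; last by case: ifP.
by rewrite mem_set// (le_trans (hM Ax By))// ler_norm.
Qed.

Let krE x : (if x \in A then \int[mu]_(y in (B : set (lebR R))) h (x, y) else 0) =
  \int[mu]_y k (x, y).
Proof.
rewrite Rintegral_mkcond; case: ifP => xA.
  by apply: eq_Rintegral => y _; rewrite patchE /k/= xA.
rewrite /k/= xA -[LHS](mul0r (fine (mu [set: lebR R]))) -Rintegral_cst//.
Qed.

Let klE y : (if y \in B then \int[mu]_(x in (A : set (lebR R))) h (x, y) else 0) =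
  \int[mu]_x k (x, y).
Proof.
rewrite Rintegral_mkcond; case: ifP => yB.
  by apply: eq_Rintegral => x _; rewrite patchE /k/= yB andbT.
rewrite -[LHS](mul0r (fine (mu [set: lebR R]))) -Rintegral_cst//.
by apply: eq_Rintegral => x _; rewrite /k/= yB andbF.
Qed.

Let Rk_le x : `|\int[mu]_y k (x, y)| <= if x \in A then `|M| * fine (mu B) else 0.
Proof.
rewrite -krE; case: ifP => [/set_mem Ax|_]; last by rewrite normr0.
rewrite ger0_norm; last by apply: Rintegral_ge0.
rewrite -Rintegral_cst// [leRHS]Rintegral_mkcond [leLHS]Rintegral_mkcond.
apply: le_Rintegral => //.
- apply: eq_integrable (ikr x) => // y _.
  by rewrite /k /= patchE mem_set.
- exact: integrable_patch_cst.
- move=> y _; rewrite !patchE; case: ifP => // /set_mem By.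
  exact: le_trans (hM Ax By) (ler_norm _).
Qed.

Lemma bounded_kernel_integrable :
  integrable (fun x => if x \in A then \int[mu]_(y in (B : set (lebR R))) h (x, y) else 0).
Proof.
under eq_fun do rewrite krE.
apply: (integrable_le (lmeasurable_Rintegralr mk)
  (integrable_patch_cst (`|M| * fine (mu B)) mA Aoo) Rk_le).
Qed.

(** In [best_error] the integral over [B] is the inner one, whereas the estimate of a block produces
    the integral over [A] inside. Since [h] is bounded on a rectangle of finite measure, all these
    integrals are finite and [fine] loses nothing. *)
Lemma bounded_kernel_fubini :
  (\int[mu]_(y in (B : set (lebR R))) (\int[mu]_(x in (A : set (lebR R))) h (x, y))%:E =
  (\int[mu]_(x in (A : set (lebR R))) \int[mu]_(y in (B : set (lebR R))) h (x, y))%:E)%E.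
Proof.
rewrite [in RHS]Rintegral_mkcond fineK; last first.
  exact: (integrable_fin_num measurableT bounded_kernel_integrable).
rewrite [in LHS]integral_mkcond.
transitivity (\int[mu]_y \int[mu]_x (k (x, y))%:E)%E.
  apply: eq_integral => y _; rewrite -[RHS]fineK; last first.
    exact: (integrable_fin_num measurableT (ikl y)).
  by rewrite -[fine _]klE patchE; case: ifP.
transitivity (\int[mu]_x \int[mu]_y (k (x, y))%:E)%E; last first.
  apply: eq_integral => x _; rewrite -[LHS]fineK; last first.
    exact: (integrable_fin_num measurableT (ikr x)).
  by rewrite -[fine _]krE patchE.
have mEk : measurable_fun [set: lebR R * lebR R] (EFin \o k).
  exact/measurable_EFinP.
have Ek0 z : (0 <= (EFin \o k) z)%E by rewrite lee_fin.
by symmetry; exact: (@fubini_tonelli _ _ _ _ _ mu mu (EFin \o k) mEk Ek0).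
Qed.

End Bounded_kernel.

End Parametric_integral.

(** * Partitions up to a null set *)

Section Partition.
Context {R : realType}.
Local Notation mu := (@completed_lebesgue_measure R).
Variables (n : nat) (P : 'I_n -> set R) (A : set R).
Hypothesis PA : partition_nonnull P A.

Let mA : measurable (A : set (lebR R)). Proof. by case: PA. Qed.

Let mP i : measurable (P i : set (lebR R)).
Proof. by case: PA => _ /(_ i)[]. Qed.

Lemma partition_ae : {ae mu, forall x, A x -> exists i, P i x}.
Proof.
exists (A `\` \bigcup_i P i); split.
- apply: measurableD => //; apply: fin_bigcup_measurable => //.
- by case: PA.
- move=> x /= /not_implyP[Ax nP]; split=> // -[i _ Pix].
  by apply: nP; exists i.
Qed.

Lemma partition_uniq i j x : P i x -> P j x -> i = j.
Proof.
move=> Pi Pj; apply: contrapT => /eqP ij.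
case: PA => _ _ /trivIsetP/(_ i j I I ij)/seteqP[/(_ x) H _] _.
exact: H.
Qed.

Lemma partition_sub i : P i `<=` A.
Proof. by case: PA => _ /(_ i)[]. Qed.

Lemma proj_partition (f : fn R) :
  ae_eq_fn (Defs.proj A f) (fun x => \sum_i Defs.proj (P i) f x).
Proof.
apply: ae_imply partition_ae => x Ax.
rewrite {1}/Defs.proj; case: ifPn => [/set_mem/Ax[i Pix]|nAx].
  rewrite (bigD1 i)//= {1}/Defs.proj mem_set// big1 ?addr0// => j ji.
  rewrite /Defs.proj; case: ifPn => // /set_mem Pjx.
  by move/eqP : ji; case; exact: partition_uniq Pjx Pix.
rewrite big1// => j _; rewrite /Defs.proj; case: ifPn => // /set_mem Pjx.
by move: nAx; rewrite mem_set//; exact: partition_sub Pjx.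
Qed.

Lemma ge0_integral_partition (h : R -> \bar R) :
  measurable_fun [set: lebR R] (h : lebR R -> \bar R) -> (forall x, 0 <= h x)%E ->
  (\int[mu]_(x in (A : set (lebR R))) h x <=
   \sum_i \int[mu]_(x in (P i : set (lebR R))) h x)%E.
Proof.
move=> mh h0; rewrite integral_mkcond.
under eq_bigr do rewrite integral_mkcond.
have mp (E : set R) : measurable (E : set (lebR R)) ->
    measurable_fun [set: lebR R] ((h : lebR R -> \bar R) \_ (E : set (lebR R))).
  move=> mE; apply/(measurable_restrictT _ mE).1.
  exact: measurable_funTS.
have p0 (E : set R) x : (0 <= ((h : lebR R -> \bar R) \_ E) x)%E.
  by rewrite patchE; case: ifP.
have <- := @ge0_integral_sum _ _ _ mu _ measurableT _ _ (fun i => mp _ (mP i))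
  (fun i x _ => p0 (P i) x) (index_enum 'I_n).
apply: ae_ge0_le_integral.
- exact: measurableT.
- by move=> x _; exact: p0.
- exact: mp.
- by move=> x _; apply: sume_ge0 => i _; exact: p0.
- by apply: emeasurable_sum => i; exact: mp.
apply: ae_imply partition_ae => x Ax _.
rewrite {1}patchE; case: ifPn => [/set_mem/Ax[i Pix]|_].
  by rewrite (bigD1 i)//= patchE mem_set// leeDl// sume_ge0.
by apply: sume_ge0 => i _; exact: p0.
Qed.

(** Up to a null set [A] is covered by finitely many pieces, each of finite measure. *)
Lemma partition_measure_lty : (mu A < +oo)%E.
Proof.
have := @ge0_integral_partition (cst 1%E) (measurable_cst _) (fun=> lee01).
rewrite integral_cst// mul1e => /le_lt_trans; apply.
apply: lte_sum_pinfty => i _; rewrite integral_cst// mul1e.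
by case: PA => _ /(_ i)[_ _ _ /andP[]].
Qed.

End Partition.

(** * The localized Fourier operator *)

Section Fourier_localization.
Context {R : realType}.
Local Notation C := R[i].
Local Notation mu := (@completed_lebesgue_measure R).
Local Notation cmeasurable f := (@complex_measurable R _ (lebR R) f).
Local Notation cmeasurable2 f := (@complex_measurable R _ (lebR R * lebR R)%type f).
Implicit Types (f g : fn R) (A B : set R) (c : R).

Lemma expiD (s t : R) : expi (s + t) = expi s * expi t.
Proof.
apply: complex_ext; rewrite ?cReM ?cImM /= mulrDr ?cosD ?sinD; ring.
Qed.

Lemma normc_expi (t : R) : Normc.normc (expi t) = 1.
Proof. by rewrite /= sqrrN cos2Dsin2 sqrtr1. Qed.

Lemma cmeasurable_fourier g : cmeasurable g -> cmeasurable (fourier g).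
Proof.
move=> mg; have mk : cmeasurable2 (fun z => expi (z.1 * z.2) * g z.1).
  apply: cmeasurableM.
    apply: cmeasurable_expi; apply: measurable_funM.
      exact: lmeasurable_fst.
    exact: lmeasurable_snd.
  by split; [exact: (measurableT_comp mg.1 measurable_fst)
            |exact: (measurableT_comp mg.2 measurable_fst)].
by split; [exact: (lmeasurable_Rintegrall mk.1)|exact: (lmeasurable_Rintegrall mk.2)].
Qed.

Lemma cmeasurable_char (xi : R) : cmeasurable (fun x => expi (x * xi)).
Proof.
apply: cmeasurable_expi; apply: measurable_funM; first exact: lmeasurable_id.
exact: measurable_cst.
Qed.

Lemma L2_char A (xi : R) : measurable (A : set (lebR R)) -> (mu A < +oo)%E ->
  L2 (Defs.proj A (fun x => expi (x * xi))).
Proof.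
move=> mA Aoo; apply: (L2_bounded_proj (M := 1) mA Aoo); first exact: cmeasurable_char.
by move=> x _; rewrite normc_expi.
Qed.

(** Moving the cut-off from [f] to the kernel makes the kernel square-integrable, ready for
    Cauchy-Schwarz. *)
Lemma proj_mulC A (k f : fn R) x : k x * Defs.proj A f x = Defs.proj A k x * f x.
Proof. by rewrite /Defs.proj; case: ifP; rewrite // mulr0 mul0r. Qed.

Lemma fourier_projE A f (xi : R) : fourier (Defs.proj A f) xi =
  cintegral (fun x => Defs.proj A (fun x => expi (x * xi)) x * f x).
Proof. by apply: eq_cintegral => x; exact: (@proj_mulC _ (fun x => expi (x * xi))). Qed.

Lemma cintegrable_fourier A f (xi : R) : measurable (A : set (lebR R)) ->
  (mu A < +oo)%E -> L2 f ->
  cintegrable (fun x => expi (x * xi) * Defs.proj A f x).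
Proof.
move=> mA Aoo Lf.
rewrite (_ : (fun x => _) = fun x => Defs.proj A (fun x => expi (x * xi)) x * f x).
  exact: L2M (L2_char _ mA Aoo) Lf.
by apply/funext => x; exact: (@proj_mulC _ (fun x => expi (x * xi))).
Qed.

Lemma sqnorm_char A (xi : R) : measurable (A : set (lebR R)) ->
  sqnorm (Defs.proj A (fun x => expi (x * xi))) = fine (mu A).
Proof.
move=> mA; rewrite sqnorm_proj -[RHS]mul1r -(Rintegral_cst _ mA).
by apply: eq_Rintegral => x _; rewrite normc_expi expr1n.
Qed.

Lemma normc_fourier_le A f (xi : R) : measurable (A : set (lebR R)) ->
  (mu A < +oo)%E -> L2 f ->
  Normc.normc (fourier (Defs.proj A f) xi) ^+ 2 <= fine (mu A) * sqnorm f.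
Proof.
move=> mA Aoo Lf; rewrite fourier_projE -(sqnorm_char xi mA).
exact: cauchy_schwarz (L2_char _ mA Aoo) Lf.
Qed.

Variables (A B : set R) (c : R).
Hypotheses (c0 : 0 < c).
Hypotheses (mA : measurable (A : set (lebR R))) (Aoo : (mu A < +oo)%E)
  (mB : measurable (B : set (lebR R))) (Boo : (mu B < +oo)%E).

Let mF f : L2 f -> cmeasurable (fourier (Defs.proj A f)).
Proof.
by move=> Lf; apply/cmeasurable_fourier/cmeasurable_proj/L2_measurable.
Qed.

(** By Cauchy-Schwarz against the character on [A] the transform is bounded by [sqrt |A|] times the
    norm of [f], and the dilate of [B] has finite measure. *)
Lemma L2_locop f : L2 f -> L2 (locop A B c f).
Proof.
move=> Lf; apply: (L2_bounded_proj (M := Num.sqrt (fine (mu A) * sqnorm f))).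
- exact: measurable_dilate.
- by rewrite lebesgue_dilate// lte_mul_pinfty// lee_fin ltW.
- exact: mF.
- move=> x _; rewrite -[leLHS]ger0_norm ?normc_nneg// -sqrtr_sqr ler_wsqrtr//.
  exact: normc_fourier_le.
Qed.

(** The equality holds at every point, because the integrals converge absolutely at every
    frequency. *)
Lemma locop_lincomb n (a : 'I_n -> C) (f : 'I_n -> fn R) :
  (forall k, L2 (f k)) ->
  locop A B c (lincomb a f) = lincomb a (fun k => locop A B c (f k)).
Proof.
move=> Lf; apply/funext => xi; rewrite /locop /lincomb {1}/Defs.proj.
case: ifPn => xiB; last first.
  by rewrite big1// => k _; rewrite /Defs.proj (negbTE xiB) mulr0.
under [RHS]eq_bigr => k _ do rewrite /Defs.proj xiB
  -/(Defs.proj A (f k)) /fourier -(cintegralZ (a k)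
     (cintegrable_fourier xi mA Aoo (Lf k))).
rewrite -cintegral_sum; last first.
  by move=> k; apply: cintegrableZ; exact: cintegrable_fourier.
apply: eq_cintegral => x; rewrite /Defs.proj; case: ifPn => _.
  by rewrite mulr_sumr; apply: eq_bigr => k _; rewrite mulrCA.
by rewrite mulr0 big1// => k _; rewrite !mulr0.
Qed.

(** Substituting [c y] for the frequency brings the integral back to [B]; its Jacobian [c] is the
    origin of the factor [sqrt c] in the envelopes. *)
Lemma sqnorm_locop f : L2 f ->
  ((sqnorm (locop A B c f))%:E = c%:E * \int[mu]_(y in (B : set (lebR R)))
     (Normc.normc (fourier (Defs.proj A f) (c * y)) ^+ 2)%:E)%E.
Proof.
move=> Lf; rewrite -(L2_sqnormE (L2_locop Lf)).
have mG : measurable_fun [set: lebR R]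
    (fun y : lebR R => (Normc.normc (fourier (Defs.proj A f) y) ^+ 2)%:E).
  by apply/measurable_EFinP; exact: cmeasurable_normc2 (mF Lf).
rewrite -(ge0_integral_dilate c0 mB mG); last by move=> x; rewrite lee_fin sqr_ge0.
rewrite [RHS]integral_mkcond; apply: eq_integral => x _.
rewrite patchE /locop {1}/Defs.proj; case: ifP => // _.
by rewrite Normc.normc0 expr0n.
Qed.

End Fourier_localization.

(** * Polynomial replacement of the phase on one block *)

Section Block_estimate.
Context {R : realType}.
Local Notation C := R[i].
Local Notation mu := (@completed_lebesgue_measure R).
Local Notation lmeasurable_fun f := (measurable_fun [set: lebR R] (f : lebR R -> R)).
Local Notation cmeasurable f := (@complex_measurable R _ (lebR R) f).
Local Notation cmeasurable2 f := (@complex_measurable R _ (lebR R * lebR R)%type f).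
Local Notation lmeasurable2 f :=
  (measurable_fun [set: lebR R * lebR R] (f : lebR R * lebR R -> R)).
Implicit Types (f g : fn R) (A B : set R) (p : {poly C}).

Lemma poly_bounded p (r : R) :
  exists M, forall z : C, Normc.normc z <= r -> Normc.normc p.[z] <= M.
Proof.
exists (\sum_(k < size p) Normc.normc p`_k * r ^+ k) => z zr.
rewrite horner_coef (le_trans (normc_sum _ _ _))// ler_sum// => k _.
rewrite Normc.normcM ler_wpM2l ?normc_nneg//.
have -> : Normc.normc (z ^+ k) = Normc.normc z ^+ k.
  elim: (nat_of_ord k) => [|n IH]; first by rewrite !expr0 Normc.normc1.
  by rewrite !exprS Normc.normcM IH.
have r0 : 0 <= r by exact: le_trans (normc_nneg z) zr.
by rewrite lerXn2r ?nnegrE ?normc_nneg.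
Qed.

Lemma bounded_setP A : bounded_set A -> exists r, forall x, A x -> `|x| <= r.
Proof. by case=> M [_ AM]; exists (M + 1) => x Ax; apply: AM => //; rewrite ltrDl. Qed.

Definition phase_error (c alpha beta : R) p (z : R * R) : C :=
  expi (c * (z.1 - alpha) * (z.2 - beta))
  - p.[((z.1 - alpha) * (z.2 - beta))%:C%C].

Lemma cmeasurable_phase_error c al be p : cmeasurable2 (phase_error c al be p).
Proof.
have m1 : lmeasurable2 (fun z => z.1 - al).
  by apply: measurable_funB; [exact: lmeasurable_fst|exact: measurable_cst].
have m2 : lmeasurable2 (fun z => z.2 - be).
  by apply: measurable_funB; [exact: lmeasurable_snd|exact: measurable_cst].
rewrite /phase_error.
rewrite (_ : (fun z => _) = fun z : lebR R * lebR R =>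
    expi (c * (z.1 - al) * (z.2 - be)) +
    (- 1) * p.[((z.1 - al) * (z.2 - be))%:C%C]); last first.
  by apply/funext => z; rewrite mulN1r.
apply: cmeasurableD.
  apply: cmeasurable_expi; apply: measurable_funM m2.
  by apply: measurable_funM m1; exact: measurable_cst.
apply: cmeasurableM; first exact: cmeasurable_cst.
by apply: cmeasurable_horner; apply: cmeasurable_real; exact: measurable_funM.
Qed.

Lemma phase_error_bounded c al be p A B : bounded_set A -> bounded_set B ->
  exists M, forall x y, A x -> B y ->
    Normc.normc (phase_error c al be p (x, y)) ^+ 2 <= M.
Proof.
move=> /bounded_setP[r Ar] /bounded_setP[s Bs].
have [M pM] := poly_bounded p ((r + `|al|) * (s + `|be|)).
exists ((1 + M) ^+ 2) => x y Ax By; rewrite /phase_error/=.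
have pz : Normc.normc p.[((x - al) * (y - be))%:C%C] <= M.
  apply: pM; rewrite normc_real normrM.
  apply: ler_pM; rewrite ?normr_ge0//.
    by rewrite (le_trans (ler_normB _ _))// lerD2r Ar.
  by rewrite (le_trans (ler_normB _ _))// lerD2r Bs.
rewrite lerXn2r ?nnegrE ?normc_nneg//.
  by rewrite addr_ge0// (le_trans _ pz)// normc_nneg.
by rewrite (le_trans (le_normcD _ _))// normcN normc_expi lerD2l.
Qed.

Lemma lmeasurable_Rintegral_in A (h : R * R -> R) : measurable (A : set (lebR R)) ->
  lmeasurable2 h ->
  lmeasurable_fun (fun y => \int[mu]_(x in (A : set (lebR R))) h (x, y)).
Proof.
move=> mA mh.
pose k z := if z.1 \in A then h z else 0.
have mk : lmeasurable2 k.
  apply: measurable_fun_ifT => //.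
  exact: (measurableT_comp (measurable_mem mA) measurable_fst).
rewrite (_ : (fun y => _) = fun y => \int[mu]_x k (x, y)).
  exact: lmeasurable_Rintegrall mk.
by apply/funext => y; rewrite Rintegral_mkcond; apply: eq_Rintegral => x _;
  rewrite patchE.
Qed.

Lemma best_error_sqr c al be p A B :
  measurable (A : set (lebR R)) -> (mu A < +oo)%E -> bounded_set A ->
  measurable (B : set (lebR R)) -> (mu B < +oo)%E -> bounded_set B ->
  (\int[mu]_(y in (B : set (lebR R))) (\int[mu]_(x in (A : set (lebR R)))
     (Normc.normc (phase_error c al be p (x, y)) ^+ 2))%:E =
   (best_error c A B al be p ^+ 2)%:E)%E.
Proof.
move=> mA Aoo bA mB Boo bB.
have [M hM] := phase_error_bounded c al be p bA bB.
have mh : lmeasurable2 (fun z => Normc.normc (phase_error c al be p z) ^+ 2).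
  exact: cmeasurable_normc2 (cmeasurable_phase_error c al be p).
rewrite (bounded_kernel_fubini mA Aoo mB Boo mh (fun z => sqr_ge0 _) hM).
rewrite /best_error sqr_sqrtr//.
by apply: Rintegral_ge0 => x _; apply: Rintegral_ge0 => y _; rewrite sqr_ge0.
Qed.

(** The weight [expi (c * x * beta)] is the [x]-factor of the separated phase. The functional does
    not involve [eta], so that finitely many conditions serve all frequencies of the block. *)
Definition moment_functional (c : R) A (alpha beta : R) (n : nat) f : C :=
  cintegral (fun x => ((x - alpha) ^+ n)%:C%C * expi (c * x * beta)
                      * Defs.proj A f x).

Lemma L2_bounded_mulC A (k : fn R) f (M : R) : measurable (A : set (lebR R)) ->
  (mu A < +oo)%E -> cmeasurable k -> (forall x, A x -> Normc.normc (k x) <= M) ->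
  L2 f -> cintegrable (fun x => k x * Defs.proj A f x).
Proof.
move=> mA Aoo mk kM Lf; under eq_fun do rewrite proj_mulC.
exact: L2M (L2_bounded_proj mA Aoo mk kM) Lf.
Qed.

Lemma moment_functional_cintegrable c A al be n f : measurable (A : set (lebR R)) ->
  (mu A < +oo)%E -> bounded_set A -> L2 f ->
  cintegrable (fun x => ((x - al) ^+ n)%:C%C * expi (c * x * be)
                      * Defs.proj A f x).
Proof.
move=> mA Aoo /bounded_setP[r Ar] Lf.
apply: (@L2_bounded_mulC _ _ _ ((r + `|al|) ^+ n) mA Aoo _ _ Lf).
  apply: cmeasurableM.
    apply: cmeasurable_real; apply: measurable_funX.
    by apply: measurable_funB; [exact: lmeasurable_id|exact: measurable_cst].
  apply: cmeasurable_expi; apply: measurable_funM; last exact: measurable_cst.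
  by apply: measurable_funM; [exact: measurable_cst|exact: lmeasurable_id].
move=> x Ax; rewrite Normc.normcM normc_expi mulr1 normc_real normrX.
rewrite lerXn2r ?nnegrE ?normr_ge0//.
  by rewrite addr_ge0// (le_trans _ (Ar _ Ax)).
by rewrite (le_trans (ler_normB _ _))// lerD2r Ar.
Qed.

Lemma moment_functional_lincomb c A al be n m (a : 'I_m -> C) (f : 'I_m -> fn R) :
  measurable (A : set (lebR R)) -> (mu A < +oo)%E -> bounded_set A ->
  (forall k, L2 (f k)) ->
  moment_functional c A al be n (lincomb a f) =
  \sum_k a k * moment_functional c A al be n (f k).
Proof.
move=> mA Aoo bA Lf; rewrite /moment_functional.
under [RHS]eq_bigr => k _ do rewrite -(cintegralZ (a k)
  (moment_functional_cintegrable c al be n mA Aoo bA (Lf k))).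
rewrite -cintegral_sum; last first.
  by move=> k; apply: cintegrableZ; exact: moment_functional_cintegrable.
apply: eq_cintegral => x; rewrite /Defs.proj; case: ifPn => _.
  by rewrite mulr_sumr; apply: eq_bigr => k _; rewrite mulrCA.
by rewrite mulr0 big1// => k _; rewrite !mulr0.
Qed.

(* [x eta = (x - alpha) (eta - beta) + (x beta + alpha eta - alpha beta)], and the
   second phase has modulus one and separates into factors in [x] and [eta]. *)
Lemma normc_fourier_block c A al be p f (y : R) :
  measurable (A : set (lebR R)) -> (mu A < +oo)%E -> bounded_set A -> L2 f ->
  (forall n, (n < size p)%N -> moment_functional c A al be n f = 0) ->
  Normc.normc (fourier (Defs.proj A f) (c * y)) ^+ 2 <=
  (\int[mu]_(x in (A : set (lebR R))) (Normc.normc (phase_error c al be p (x, y)) ^+ 2))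
  * sqnorm (Defs.proj A f).
Proof.
move=> mA Aoo bA Lf vanish.
pose w x : C := expi (c * (x * be + al * y - al * be)).
pose k x : C := phase_error c al be p (x, y) * w x.
have mw : cmeasurable w.
  apply: cmeasurable_expi; apply: measurable_funM; first exact: measurable_cst.
  apply: measurable_funB; last exact: measurable_cst.
  apply: measurable_funD; last exact: measurable_cst.
  by apply: measurable_funM; [exact: lmeasurable_id|exact: measurable_cst].
have mE : cmeasurable (fun x => phase_error c al be p (x, y)).
  have [m1 m2] := cmeasurable_phase_error c al be p.
  by split; [exact: lmeasurable_pair1 m1|exact: lmeasurable_pair1 m2].
have mk : cmeasurable k by exact: cmeasurableM.
(* A single frequency is regarded as a bounded set, so that the bound for rectangles applies to the
   slice at [y]. *)
have by1 : bounded_set [set y].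
  by exists `|y|; split=> [|M /ltW yM _ ->]; rewrite ?num_real.
have [M hM] := phase_error_bounded c al be p bA by1.
have kM x : A x -> Normc.normc (k x) <= Num.sqrt M.
  move=> Ax; rewrite /k Normc.normcM normc_expi mulr1.
  by rewrite -[leLHS]ger0_norm ?normc_nneg// -sqrtr_sqr ler_wsqrtr// hM.
have Lk := L2_bounded_proj mA Aoo mk kM.
(* The factor of the [n]-th term that does not depend on [x]; the remaining factor integrates
   against [f] to a moment. *)
pose coef (n : nat) : C :=
  p`_n * ((y - be) ^+ n)%:C%C * expi (c * (al * y - al * be)).
have split x : expi (x * (c * y)) = k x + \sum_(n < size p)
    coef n * (((x - al) ^+ n)%:C%C * expi (c * x * be)).
  have -> : expi (x * (c * y)) = expi (c * (x - al) * (y - be)) * w x.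
    by rewrite /w -expiD; congr expi; ring.
  rewrite /k /phase_error/= mulrBl -addrA -[LHS]addr0; congr (_ + _).
  apply/esym/eqP; rewrite addrC subr_eq0; apply/eqP.
  have -> : w x = expi (c * (al * y - al * be)) * expi (c * x * be).
    by rewrite /w -expiD; congr expi; ring.
  rewrite horner_coef mulr_suml; apply: eq_bigr => n _.
  by rewrite /coef rmorphM/= exprMn rmorphXn/= rmorphXn/=; ring.
have FE : fourier (Defs.proj A f) (c * y) =
    cintegral (fun x => Defs.proj A k x * Defs.proj A f x).
  rewrite /fourier (_ : (fun x => _) = fun x =>
      Defs.proj A k x * Defs.proj A f x + \sum_(n < size p)
      coef n * (((x - al) ^+ n)%:C%C * expi (c * x * be) * Defs.proj A f x)).
    have iG (n : 'I_(size p)) := moment_functional_cintegrable c al be n mA Aoo bA Lf.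
    rewrite cintegralD; last 2 first.
    - exact: L2M Lk (L2_proj mA Lf).
    - by apply: cintegrable_sum => n; apply: cintegrableZ; exact: iG.
    rewrite [X in _ + X]cintegral_sum; last by move=> n; apply: cintegrableZ; exact: iG.
    rewrite big1 ?addr0// => n _; rewrite cintegralZ; last exact: iG.
    by rewrite -/(moment_functional _ _ _ _ _ _) vanish// mulr0.
  apply/funext => x; rewrite split mulrDl mulr_suml; congr (_ + _).
    by rewrite /Defs.proj; case: ifP; rewrite // !mulr0.
  by apply: eq_bigr => n _; rewrite !mulrA.
rewrite FE (le_trans (cauchy_schwarz Lk (L2_proj mA Lf)))//.
rewrite ler_wpM2r ?sqnorm_ge0// le_eqVlt; apply/orP; left; apply/eqP.
rewrite sqnorm_proj; apply: eq_Rintegral => x _.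
by rewrite /k Normc.normcM normc_expi mulr1.
Qed.

End Block_estimate.

(** * Positive definite hermitian forms *)

Section Positive_definite.
Context {R : realType}.
Local Notation C := R[i].
Variables (n : nat) (H : 'I_n -> 'I_n -> C).
Implicit Types a b : 'I_n -> C.

(** Linear in [a] and conjugate-linear in [b], like [inner]: with a Gram matrix for [H] it gives the
    inner product of two linear combinations. *)
Definition sesqui a b : C := \sum_k \sum_l a k * (b l)^*%C * H k l.

Lemma sesqui_subl a b d (z : C) :
  sesqui (fun k => a k - z * b k) d = sesqui a d - z * sesqui b d.
Proof.
rewrite /sesqui mulr_sumr -sumrB; apply: eq_bigr => k _.
by rewrite mulr_sumr -sumrB; apply: eq_bigr => l _; ring.
Qed.

Hypothesis herm : forall k l, H l k = (H k l)^*%C.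
Hypothesis pos : forall a, (exists k, a k != 0) -> 0 < complex.Re (sesqui a a).

Lemma sesquiJ a b : sesqui b a = (sesqui a b)^*%C.
Proof.
rewrite /sesqui exchange_big cJ_sum; apply: eq_bigr => k _ /=.
rewrite cJ_sum; apply: eq_bigr => l _.
by rewrite !cJM conjcK -herm; ring.
Qed.

Lemma sesqui_subr a b d (z : C) :
  sesqui d (fun k => a k - z * b k) = sesqui d a - z^*%C * sesqui d b.
Proof.
rewrite sesquiJ sesqui_subl [sesqui d a]sesquiJ [sesqui d b]sesquiJ.
case: (sesqui a d) => ? ?; case: (sesqui b d) => ? ?; case: z => ? ?.
by apply: complex_ext => /=; ring.
Qed.

Lemma sesqui_ge0 a : 0 <= complex.Re (sesqui a a).
Proof.
have [[k ak]|na] := pselect (exists k, a k != 0); first by apply/ltW/pos; exists k.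
rewrite /sesqui big1// => k _; rewrite big1// => l _.
have -> : a k = 0 by apply: contrapT => /eqP ak; apply: na; exists k.
by rewrite !mul0r.
Qed.

(* Positive definiteness makes [H] invertible, so that each coordinate is
   represented by some vector [w] for the form [sesqui]. *)
Lemma coordinate_riesz k : exists w, forall a, sesqui a w = a k.
Proof.
pose A : 'M[C]_n := \matrix_(i, j) H i j.
have uA : A \in unitmx.
  rewrite -row_free_unit -kermx_eq0; apply/rowV0P => v /sub_kermxP vA.
  apply/rowP => i; rewrite mxE; apply: contrapT => /eqP vi.
  have /pos : exists k, v 0 k != 0 by exists i.
  suff -> : sesqui (v 0) (v 0) = 0 by rewrite ltxx.
  rewrite /sesqui exchange_big big1// => l _ /=.
  have /rowP/(_ l) := vA; rewrite !mxE => vl.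
  rewrite (_ : \sum_i _ = (v 0 l)^*%C * \sum_j v 0 j * A j l); last first.
    by rewrite mulr_sumr; apply: eq_bigr => j _; rewrite mxE; ring.
  by rewrite vl mulr0.
pose u := invmx A *m delta_mx k (0 : 'I_1).
exists (fun l => (u l 0)^*%C) => a.
rewrite /sesqui (bigD1 k)//= (_ : \sum_l _ = a k); last first.
  have : (A *m u) k 0 = 1 by rewrite mulKVmx// mxE !eqxx.
  rewrite mxE => e; rewrite -[RHS]mulr1 -e mulr_sumr.
  by apply: eq_bigr => l _; rewrite conjcK !mxE; ring.
rewrite big1 ?addr0// => j jk.
have : (A *m u) j 0 = 0 by rewrite mulKVmx// mxE (negbTE jk).
rewrite mxE => e; transitivity (a j * 0); last by rewrite mulr0.
rewrite -[X in _ = _ * X]e mulr_sumr.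
by apply: eq_bigr => l _; rewrite conjcK !mxE; ring.
Qed.

(** Cauchy-Schwarz for the form itself, applied to [a] and the vector [w] representing the
    coordinate, with [q] the value of the form at [w]. It is read off from nonnegativity at
    [a - z w], where [z = a k / q] is the projection coefficient. *)
Lemma coordinate_le k : exists q : R, forall a,
  Normc.normc (a k) ^+ 2 <= q * complex.Re (sesqui a a).
Proof.
have [w wk] := coordinate_riesz k.
(* The represented coordinate takes the value 1 at the constant vector, so [w] is nonzero and [q] is
   positive. *)
have w0 : exists l, w l != 0.
  apply: contrapT => nw; have := wk (fun=> 1).
  have w0 l : w l = 0 by apply: contrapT => /eqP wl; apply: nw; exists l.
  rewrite /sesqui big1 => [/eqP|i _].
    by rewrite eq_sym oner_eq0.
  by rewrite big1// => l _; rewrite w0 conjc0 mulr0 mul0r.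
have q0 := pos w0; set q := complex.Re (sesqui w w) in q0.
exists q => a; pose z : C := a k * (q^-1)%:C%C.
have := sesqui_ge0 (fun l => a l - z * w l).
rewrite sesqui_subl !sesqui_subr [sesqui w a]sesquiJ !wk.
have -> : complex.Re (sesqui a a - z^*%C * a k - z * ((a k)^*%C - z^*%C * w k)) =
    complex.Re (sesqui a a) - Normc.normc (a k) ^+ 2 / q.
  have qE : q = complex.Re (w k) by rewrite /q wk.
  rewrite /z; move: qE; case: (sesqui a a) => s1 s2; case: (a k) => x y.
  case: (w k) => u v /= qE; rewrite sqr_sqrtr ?addr_ge0 ?sqr_ge0// -qE.
  by field; rewrite gt_eqF.
by rewrite subr_ge0 ler_pdivrMr// mulrC.
Qed.

(** Summing the coordinate estimates takes the place of compactness of the unit sphere. *)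
Lemma posdef_lower : exists2 q : R, 0 < q &
  forall a, \sum_k Normc.normc (a k) ^+ 2 <= q * complex.Re (sesqui a a).
Proof.
have /choice[q qP] : forall k, exists q : R, forall a,
  Normc.normc (a k) ^+ 2 <= q * complex.Re (sesqui a a).
  by move=> k; exact: coordinate_le.
(* The summand 1 keeps the constant positive, even when there are no coordinates. *)
exists (1 + \sum_k `|q k|) => [|a].
  by rewrite ltr_pwDl// sumr_ge0.
rewrite mulrDl mul1r mulr_suml.
apply: (@le_trans _ _ (\sum_k `|q k| * complex.Re (sesqui a a))).
  apply: ler_sum => k _; apply: le_trans (qP k a) _.
  by rewrite ler_wpM2r ?sesqui_ge0 ?ler_norm.
by rewrite lerDr sesqui_ge0.
Qed.

Lemma sesqui_le a : complex.Re (sesqui a a) <=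
  (\sum_k \sum_l Normc.normc (H k l)) * \sum_k Normc.normc (a k) ^+ 2.
Proof.
set s := \sum_k Normc.normc (a k) ^+ 2.
have as_le k : Normc.normc (a k) ^+ 2 <= s.
  by rewrite /s (bigD1 k)//= lerDl sumr_ge0// => l _; rewrite sqr_ge0.
rewrite (le_trans (ler_norm _))// (le_trans (normcRe_le _))//.
rewrite (le_trans (normc_sum _ _ _))// mulr_suml ler_sum// => k _.
rewrite (le_trans (normc_sum _ _ _))// mulr_suml ler_sum// => l _.
rewrite !Normc.normcM normc_conj [leRHS]mulrC ler_wpM2r ?normc_nneg//.
have := as_le k; have := as_le l.
have := sqr_ge0 (Normc.normc (a k) - Normc.normc (a l)); nra.
Qed.

End Positive_definite.

(** * Assembly of the blocks under vanishing moments *)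

Section Finite_rank_approximation.
Context {R : realType}.
Local Notation C := R[i].
Local Notation mu := (@completed_lebesgue_measure R).
Variables (c : R) (M K : nat) (A B : set R).
Variables (Ai : 'I_M -> set R) (Bj : 'I_K -> set R) (N : 'M[nat]_(K, M)).
Hypotheses (c0 : 0 < c) (PA : partition_nonnull Ai A) (PB : partition_nonnull Bj B).
Local Notation T := (locop A B c).
Local Notation total := (\sum_(j < K) \sum_(i < M) N j i)%N.

Let mA : measurable (A : set (lebR R)). Proof. by case: PA. Qed.
Let mB : measurable (B : set (lebR R)). Proof. by case: PB. Qed.
Let Aoo : (mu A < +oo)%E. Proof. exact: partition_measure_lty PA. Qed.
Let Boo : (mu B < +oo)%E. Proof. exact: partition_measure_lty PB. Qed.
Let mAi i : measurable (Ai i : set (lebR R)).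
Proof. by case: PA => _ /(_ i)[]. Qed.
Let mBj i : measurable (Bj i : set (lebR R)).
Proof. by case: PB => _ /(_ i)[]. Qed.
Let bAi i : bounded_set (Ai i). Proof. by case: PA => _ /(_ i)[]. Qed.
Let bBj i : bounded_set (Bj i). Proof. by case: PB => _ /(_ i)[]. Qed.
Let Aioo i : (mu (Ai i) < +oo)%E.
Proof. by case: PA => _ /(_ i)[_ _ _ /andP[]]. Qed.
Let Bjoo i : (mu (Bj i) < +oo)%E.
Proof. by case: PB => _ /(_ i)[_ _ _ /andP[]]. Qed.

(** The pieces exhaust [A] only almost everywhere, but integrals do not see the difference, so the
    identity holds at every frequency. *)
Lemma fourier_partition f xi : L2 f ->
  fourier (Defs.proj A f) xi = \sum_i fourier (Defs.proj (Ai i) f) xi.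
Proof.
move=> Lf; rewrite /fourier -cintegral_sum; last first.
  by move=> i; exact: cintegrable_fourier.
apply: ae_eq_cintegral.
- exact/cintegrable_measurable/cintegrable_fourier.
- apply: cintegrable_measurable; apply: cintegrable_sum => i.
  exact: cintegrable_fourier.
- by apply: ae_imply (proj_partition PA f) => x ->; rewrite mulr_sumr.
Qed.

(** For [y] fixed, the block estimates bound the modulus of the transform by
    [sum_i sqrt (G j i y) * v i]. The weighted inequality with weights [b j i] makes the square
    linear in [G j i y], whose integral over the [j]-th piece is the squared block error, at most
    [b j i ^+ 2]. One weight cancels, and the sum becomes the square of [S j]. *)
Lemma sqnorm_locop_le (al be b : 'I_K -> 'I_M -> R) (p : 'I_K -> 'I_M -> {poly C}) f :
  L2 f -> (forall j i, 0 < b j i) ->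
  (forall j i, best_error c (Ai i) (Bj j) (al j i) (be j i) (p j i) <= b j i) ->
  (forall j i n, (n < size (p j i))%N ->
     moment_functional c (Ai i) (al j i) (be j i) n f = 0) ->
  sqnorm (T f) <= c * \sum_j
    (\sum_i b j i * Num.sqrt (sqnorm (Defs.proj (Ai i) f))) ^+ 2.
Proof.
move=> Lf b0 bb vanish.
pose v i := Num.sqrt (sqnorm (Defs.proj (Ai i) f)).
have v0 i : 0 <= v i by exact: sqrtr_ge0.
have v2 i : v i ^+ 2 = sqnorm (Defs.proj (Ai i) f).
  by rewrite sqr_sqrtr// sqnorm_ge0.
pose G j i y := \int[mu]_(x in (Ai i : set (lebR R)))
  (Normc.normc (phase_error c (al j i) (be j i) (p j i) (x, y)) ^+ 2).
have G0 j i y : 0 <= G j i y by apply: Rintegral_ge0 => x _; rewrite sqr_ge0.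
have mG j i : measurable_fun [set: lebR R] (fun y : lebR R => (G j i y)%:E).
  apply/measurable_EFinP.
  apply: (@lmeasurable_Rintegral_in _ (Ai i) (fun z => Normc.normc (phase_error c
    (al j i) (be j i) (p j i) z) ^+ 2) (mAi i)).
  exact: cmeasurable_normc2 (cmeasurable_phase_error _ _ _ _).
pose S j := \sum_i b j i * v i.
have S0 j : 0 <= S j by rewrite sumr_ge0// => i _; rewrite mulr_ge0// ltW.
have w0 j i : 0 <= S j * (v i / b j i) by rewrite mulr_ge0// divr_ge0// ltW.
pose F y := fourier (Defs.proj A f) (c * y).
have mF : measurable_fun [set: lebR R] (fun y : lebR R => (Normc.normc (F y) ^+ 2)%:E).
  apply/measurable_EFinP.
  have mg := cmeasurable_normc2 (cmeasurable_fourier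
    (cmeasurable_proj mA (L2_measurable Lf))).
  exact: (measurableT_comp mg (measurable_mull c0)).
have pw j y : Normc.normc (F y) ^+ 2 <= \sum_i S j * (v i / b j i) * G j i y.
  rewrite /F fourier_partition//.
  apply: (@le_trans _ _ ((\sum_i Num.sqrt (G j i y) * v i) ^+ 2)).
    rewrite lerXn2r ?nnegrE ?normc_nneg//.
      by rewrite sumr_ge0// => i _; rewrite mulr_ge0// sqrtr_ge0.
    rewrite (le_trans (normc_sum _ _ _))// ler_sum// => i _.
    rewrite -(ler_pXn2r (n := 2))// ?nnegrE ?normc_nneg ?mulr_ge0 ?sqrtr_ge0//.
    rewrite exprMn v2 (sqr_sqrtr (G0 j i y)).
    exact: (normc_fourier_block y (mAi i) (Aioo i) (bAi i) Lf (vanish j i)).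
  apply: le_trans (weighted_cauchy_schwarz _ (b0 j) v0) _.
  rewrite mulr_sumr; apply: ler_sum => i _.
  by rewrite sqr_sqrtr// mulrA.
have block j : (\int[mu]_(y in (Bj j : set (lebR R))) (Normc.normc (F y) ^+ 2)%:E
    <= (S j ^+ 2)%:E)%E.
  have mT (h : lebR R -> \bar R) : measurable_fun setT h ->
    measurable_fun (Bj j : set (lebR R)) h by exact: measurable_funTS.
  apply: (@le_trans _ _ (\int[mu]_(y in (Bj j : set (lebR R)))
     \sum_i ((S j * (v i / b j i))%:E * (G j i y)%:E))%E).
    apply: (ge0_le_integral mu (mBj j)).
    - by move=> y _; rewrite lee_fin sqr_ge0.
    - exact: mT.
    - apply: emeasurable_sum => i; apply: mT.
      exact: (measurable_funeM _ (mG j i)).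
    - by move=> y _; rewrite sumEFin lee_fin pw.
  rewrite (@ge0_integral_sum _ _ _ mu _ (mBj j)); last 2 first.
    - by move=> i; apply: mT; exact: (measurable_funeM _ (mG j i)).
    - by move=> i y _; rewrite -EFinM lee_fin mulr_ge0.
  rewrite expr2 {2}/S mulr_sumr -sumEFin; apply: lee_sum => i _.
  rewrite (ge0_integralZl mu (mBj j) (mT _ (mG j i))); last 2 first.
    - by move=> y _; rewrite lee_fin.
    - by rewrite lee_fin.
  rewrite best_error_sqr// -EFinM lee_fin -mulrA ler_wpM2l//.
  rewrite mulrAC -mulrA [leRHS]mulrC ler_wpM2l//.
  have be0 : 0 <= best_error c (Ai i) (Bj j) (al j i) (be j i) (p j i).
    exact: sqrtr_ge0.
  by rewrite ler_pdivrMr// expr2 ler_pM// ltW.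
have sB := ge0_integral_partition PB mF (fun y => sqr_ge0 (Normc.normc (F y))).
rewrite -lee_fin (sqnorm_locop c0 mA Aoo mB Boo Lf) EFinM lee_wpmul2l//.
  by rewrite lee_fin ltW.
by apply: le_trans sB _; rewrite -sumEFin; apply: lee_sum => j _; exact: block.
Qed.

Lemma Ebest_ge0 j i : 0 <= Ebest c Ai Bj N j i.
Proof.
rewrite mxE mulr_ge0 ?sqrtr_ge0//; apply: lb_le_inf.
  by exists (best_error c (Ai i) (Bj j) 0 0 0), 0, 0, 0; rewrite size_poly0.
by move=> _ [? [? [? [_ ->]]]]; exact: sqrtr_ge0.
Qed.

Lemma Ebest_approx (t : R) j i : 0 < t ->
  exists al be (p : {poly C}), (size p <= N j i)%N /\
    Num.sqrt c * best_error c (Ai i) (Bj j) al be p < Ebest c Ai Bj N j i + t.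
Proof.
move=> t0; have sc0 : 0 < Num.sqrt c by rewrite sqrtr_gt0.
set S := [set y | exists alpha beta (p : {poly C}),
     (size p <= N j i)%N /\ y = best_error c (Ai i) (Bj j) alpha beta p].
have hS : has_inf S.
  split; first by exists (best_error c (Ai i) (Bj j) 0 0 0), 0, 0, 0; rewrite size_poly0.
  by exists 0 => _ [? [? [? [_ ->]]]]; exact: sqrtr_ge0.
have ts0 : 0 < t / Num.sqrt c by rewrite divr_gt0.
have [_ [al [be [p [sp ->]]]] lt] := inf_adherent ts0 hS.
exists al, be, p; split=> //; rewrite mxE -/S.
by rewrite mulrC -ltr_pdivlMr// mulrDl mulrAC mulfV ?gt_eqF// mul1r.
Qed.

(* The infimum defining [Ebest] need not be attained, whence the slack [t]. *)
Lemma sqnorm_locop_opnorm (t : R) : 0 < t ->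
  exists al be : 'I_K -> 'I_M -> R, forall f, L2 f ->
    (forall j i n, (n < N j i)%N ->
       moment_functional c (Ai i) (al j i) (be j i) n f = 0) ->
    sqnorm (T f) <= (opnorm (Ebest c Ai Bj N) ^+ 2 + t) * sqnorm f.
Proof.
move=> t0; set E := Ebest c Ai Bj N.
(* The cost of raising every entry by [s <= 1]: with [W = sum_i v_i], the square of row [j] grows by
   at most [s W^2 (2 sum_i E_ji + 1)], and [W^2 <= M sum_i v_i^2]. Summing over [j] gives
   [s D sum_i v_i^2]. *)
pose D := M%:R * (2 * \sum_j \sum_i E j i + K%:R) : R.
have E0 j i : 0 <= E j i by exact: Ebest_ge0.
have D0 : 0 <= D.
  rewrite mulr_ge0 ?ler0n// addr_ge0 ?ler0n// mulr_ge0// sumr_ge0// => j _.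
  by rewrite sumr_ge0.
(* The bound 1 absorbs [s^2] into [s]; the other one makes [s * D] at most [t]. Positivity of [s]
   makes the weights [b] below positive. *)
pose s := Num.min 1 (t / (D + 1)).
have s0 : 0 < s by rewrite lt_min ltr01 divr_gt0// ltr_wpDl.
have s1 : s <= 1 by rewrite ge_min lexx.
have sD : s * D <= t.
  apply: (@le_trans _ _ (t / (D + 1) * D)).
    by rewrite ler_wpM2r// ge_min lexx orbT.
  by rewrite mulrAC ler_pdivrMr ?ltr_wpDl// ler_wpM2l ?(ltW t0)// lerDl.
have /choice[al /choice[be /choice[p ap]]] : forall ji : 'I_K * 'I_M,
  exists al be (p : {poly C}), (size p <= N ji.1 ji.2)%N /\
    Num.sqrt c * best_error c (Ai ji.2) (Bj ji.1) al be p < E ji.1 ji.2 + s.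
  by move=> ji; exact: Ebest_approx.
exists (fun j i => al (j, i)), (fun j i => be (j, i)) => f Lf vanish.
pose v i := Num.sqrt (sqnorm (Defs.proj (Ai i) f)).
have v0 i : 0 <= v i by exact: sqrtr_ge0.
have sc0 : 0 < Num.sqrt c by rewrite sqrtr_gt0.
pose b j i := (E j i + s) / Num.sqrt c.
have := @sqnorm_locop_le (fun j i => al (j, i)) (fun j i => be (j, i)) b
  (fun j i => p (j, i)) f Lf.
have b0 j i : 0 < b j i by rewrite divr_gt0// ltr_wpDl.
have bb j i : best_error c (Ai i) (Bj j) (al (j, i)) (be (j, i)) (p (j, i)) <= b j i.
  by rewrite ler_pdivlMr// mulrC ltW//; exact: (ap (j, i)).2.
have vv j i n : (n < size (p (j, i)))%N ->
    moment_functional c (Ai i) (al (j, i)) (be (j, i)) n f = 0.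
  by move=> np; apply: vanish; exact: leq_trans np (ap (j, i)).1.
move=> /(_ b0 bb vv) /le_trans; apply.
pose V := \sum_i v i ^+ 2; pose W := \sum_i v i.
have V0 : 0 <= V by rewrite sumr_ge0// => i _; rewrite sqr_ge0.
have W0 : 0 <= W by rewrite sumr_ge0.
have VF : V <= sqnorm f.
  rewrite (le_trans _ (sum_sqnorm_proj mAi _ Lf))//; last by case: PA.
  by apply: ler_sum => i _; rewrite sqr_sqrtr// sqnorm_ge0.
have W2 : W ^+ 2 <= M%:R * V.
  have := @weighted_cauchy_schwarz R M (fun=> 1) v (fun=> 1) (fun=> ltr01) (fun=> ler01).
  under eq_bigr do rewrite mulr1.
  under [X in _ <= X * _ -> _]eq_bigr do rewrite mulr1.
  under [X in _ <= _ * X -> _]eq_bigr do rewrite divr1 mul1r.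
  by rewrite sumr_const card_ord.
have -> : c * \sum_j (\sum_i b j i * v i) ^+ 2 =
    \sum_j (\sum_i E j i * v i + s * W) ^+ 2.
  rewrite mulr_sumr; apply: eq_bigr => j _.
  rewrite -{1}(sqr_sqrtr (ltW c0)) -exprMn mulr_sumr; congr (_ ^+ 2).
  rewrite /W mulr_sumr -big_split; apply: eq_bigr => i _ /=.
  by rewrite /b; field; rewrite gt_eqF.
have vW i : v i <= W by rewrite /W (bigD1 i)//= lerDl sumr_ge0.
have EW j : \sum_i E j i * v i <= (\sum_i E j i) * W.
  by rewrite mulr_suml ler_sum// => i _; rewrite ler_wpM2l.
apply: (@le_trans _ _ (\sum_j ((\sum_i E j i * v i) ^+ 2 +
    s * W ^+ 2 * (2 * \sum_i E j i + 1)))).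
  apply: ler_sum => j _.
  have := EW j; set a := \sum_i E j i * v i; set e := \sum_i E j i => ae.
  have ss : s * s <= s by rewrite ler_piMl// ltW.
  have sW0 : 0 <= s * W by rewrite mulr_ge0// ltW.
  have := ler_wpM2l sW0 ae; have := ler_wpM2r (sqr_ge0 W) ss; nra.
rewrite big_split/= -mulr_sumr big_split/= sumr_const card_ord -mulr_sumr.
rewrite [leRHS]mulrDl lerD//.
  apply: le_trans (opnorm_sumsq E v) _.
  by rewrite ler_wpM2l ?sqr_ge0.
set X := 2 * _ + _.
have X0 : 0 <= X.
  by rewrite addr_ge0 ?ler0n// mulr_ge0// sumr_ge0// => j _; rewrite sumr_ge0.
apply: (@le_trans _ _ (s * D * V)); last first.
  by rewrite ler_pM// mulr_ge0// ltW.
rewrite /D -/X -!mulrA ler_wpM2l ?(ltW s0)//.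
have := ler_wpM2r X0 W2; nra.
Qed.

(* There are [total] moment functionals, so they have a common zero among the
   combinations of any [n > total] functions. *)
Lemma small_lincomb n (f : 'I_n -> fn R) (t : R) : (total < n)%N ->
  (forall k, L2 (f k)) -> 0 < t ->
  exists a : 'I_n -> C, (exists k, a k != 0) /\
    sqnorm (T (lincomb a f)) <=
    (opnorm (Ebest c Ai Bj N) ^+ 2 + t) * sqnorm (lincomb a f).
Proof.
move=> tn Lf t0; have [al [be bound]] := sqnorm_locop_opnorm t0.
pose J := {x : 'I_K * 'I_M & 'I_(N x.1 x.2)}.
have cardJ : (#|{: J}| < n)%N.
  rewrite card_tagged sumnE big_map big_enum/=.
  under eq_bigr do rewrite card_ord.
  by rewrite -(pair_bigA _ (fun j i => N j i))/=.
have [a [a0 aL]] := @common_kernel C J n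
  (fun k x => moment_functional c (Ai (tag x).2) (al (tag x).1 (tag x).2)
     (be (tag x).1 (tag x).2) (tagged x) (f k)) cardJ.
exists a; split=> //; apply: bound; first exact: L2_lincomb.
move=> j i m mN; rewrite moment_functional_lincomb//.
exact: (aL (existT (fun x : 'I_K * 'I_M => 'I_(N x.1 x.2)) (j, i) (Ordinal mN))).
Qed.

End Finite_rank_approximation.

(** * Moments and essential suprema *)

Section Moments.
Context {R : realType}.
Local Notation mu := (@completed_lebesgue_measure R).
Local Notation lmeasurable_fun f := (measurable_fun [set: lebR R] (f : lebR R -> R)).
Implicit Types (A B E : set R).

(** This allows the centres of the two moments in a product to be optimised independently. The
    infimum is taken in one factor at a time, dividing by the other, and a vanishing factor is
    treated apart. *)
Lemma le_mul_inf (S S' : set R) (q : R) : S !=set0 -> S' !=set0 ->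
  (forall a, S a -> 0 <= a) -> (forall b, S' b -> 0 <= b) ->
  (forall a b, S a -> S' b -> q <= a * b) -> q <= inf S * inf S'.
Proof.
move=> S0 S'0 Sge S'ge H.
have i0 : 0 <= inf S' by apply: lb_le_inf => // b; exact: S'ge.
have H1 a : S a -> q <= a * inf S'.
  move=> Sa; have := Sge a Sa; rewrite le_eqVlt => /orP[/eqP a0|a0].
    by have [b S'b] := S'0; have := H a b Sa S'b; rewrite -a0 !mul0r.
  rewrite mulrC -ler_pdivrMr//; apply: lb_le_inf => // b S'b.
  by rewrite ler_pdivrMr// mulrC; exact: H.
move: i0; rewrite le_eqVlt => /orP[/eqP i0|i0].
  by have [a Sa] := S0; have := H1 a Sa; rewrite -i0 !mulr0.
by rewrite -ler_pdivrMr//; apply: lb_le_inf => // a Sa; rewrite ler_pdivrMr// H1.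
Qed.

Lemma integrable_bounded_on E (h : R -> R) (M : R) : measurable (E : set (lebR R)) ->
  (mu E < +oo)%E -> lmeasurable_fun h -> (forall x, E x -> `|h x| <= M) ->
  mu.-integrable (E : set (lebR R)) (EFin \o (h : lebR R -> R)).
Proof.
move=> mE Eoo mh hM; apply: (measurable_bounded_integrable mE Eoo).
  exact: measurable_funTS.
by exists M; split=> [|x /ltW Mx y Ey];
  [rewrite num_real|exact: le_trans (hM y Ey) Mx].
Qed.

Lemma lmeasurable_power (N : nat) (a : R) : lmeasurable_fun (fun x => `|x - a| ^+ N).
Proof.
apply: measurable_funX; apply: measurableT_comp; first exact: normr_measurable.
by apply: measurable_funB; [exact: lmeasurable_id|exact: measurable_cst].
Qed.

Lemma integrable_power E (N : nat) (a : R) : measurable (E : set (lebR R)) ->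
  (mu E < +oo)%E -> bounded_set E ->
  mu.-integrable (E : set (lebR R)) (EFin \o ((fun x => `|x - a| ^+ N) : lebR R -> R)).
Proof.
move=> mE Eoo /bounded_setP[r Er].
apply: (@integrable_bounded_on _ _ ((r + `|a|) ^+ N) mE Eoo).
  exact: lmeasurable_power.
move=> x Ex; rewrite ger0_norm ?exprn_ge0// lerXn2r ?nnegrE ?normr_ge0//.
  by rewrite addr_ge0// (le_trans _ (Er _ Ex)).
by rewrite (le_trans (ler_normB _ _))// lerD2r Er.
Qed.

(** The squared Taylor bound is a product of a power of [|x - al|] and a power of [|y - be|], so its
    double integral factors into two moments. *)
Lemma best_error_taylor_le (c : R) A B (al be : R) (N : nat) : 0 < c ->
  measurable (A : set (lebR R)) -> (mu A < +oo)%E -> bounded_set A ->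
  measurable (B : set (lebR R)) -> (mu B < +oo)%E -> bounded_set B ->
  best_error c A B al be (taylor_poly c N) <=
  (2 * pi * c) ^+ N / N`!%:R *
  Num.sqrt ((\int[mu]_(x in (A : set (lebR R))) `|x - al| ^+ (2 * N)) *
            \int[mu]_(y in (B : set (lebR R))) `|y - be| ^+ (2 * N)).
Proof.
move=> c0 mA Aoo bA mB Boo bB.
set L := (2 * pi * c) ^+ N / N`!%:R.
have L0 : 0 <= L.
  by rewrite divr_ge0 ?ler0n// exprn_ge0// mulr_ge0 ?(ltW c0)// mulr_ge0// pi_ge0.
set IA := \int[mu]_(x in _) _; set IB := \int[mu]_(y in _) _.
have IB0 : 0 <= IB by apply: Rintegral_ge0 => y _; rewrite exprn_ge0.
rewrite -[L in leRHS]ger0_norm// -sqrtr_sqr -sqrtrM ?sqr_ge0//.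
rewrite /best_error ler_wsqrtr//.
pose phi z := Normc.normc (phase_error c al be (taylor_poly c N) z) ^+ 2.
have phi_le x y : phi (x, y) <= L ^+ 2 * `|x - al| ^+ (2 * N) * `|y - be| ^+ (2 * N).
  have := normc_expi_taylor c ((x - al) * (y - be)) N.
  rewrite /phi /phase_error /= mulrA => h.
  rewrite [(2 * N)%N]mulnC !exprM.
  have -> : L ^+ 2 * (`|x - al| ^+ N) ^+ 2 * (`|y - be| ^+ N) ^+ 2 =
      (`|2 * pi * c * ((x - al) * (y - be))| ^+ N / N`!%:R) ^+ 2.
    have -> : `|2 * pi * c * ((x - al) * (y - be))| =
        2 * pi * c * (`|x - al| * `|y - be|).
      rewrite normrM ger0_norm ?normrM// mulr_ge0 ?(ltW c0)// mulr_ge0// pi_ge0//.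
    rewrite /L; move: (2 * pi * c) (`|x - al|) (`|y - be|) (N`!%:R) => u a b w.
    by rewrite !exprMn; ring.
  by rewrite lerXn2r ?nnegrE ?normc_nneg// divr_ge0 ?ler0n ?exprn_ge0.
have mphi : measurable_fun [set: lebR R * lebR R] (phi : lebR R * lebR R -> R).
  exact: cmeasurable_normc2 (cmeasurable_phase_error c al be _).
have [M hM] := phase_error_bounded c al be (taylor_poly c N) bA bB.
rewrite -[leLHS]/(\int[mu]_(x in (A : set (lebR R)))
    \int[mu]_(y in (B : set (lebR R))) phi (x, y)).
have iphi : mu.-integrable (A : set (lebR R))
    (EFin \o ((fun x => \int[mu]_(y in (B : set (lebR R))) phi (x, y)) : lebR R -> R)).
  apply/(integrable_mkcond _ mA).2.
  have := bounded_kernel_integrable mA Aoo mB Boo mphi (fun z => sqr_ge0 _) hM.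
  apply: eq_integrable => // x _.
  by rewrite patchE /=; case: ifP.
have iA := integrable_power (2 * N) al mA Aoo bA.
have iB := integrable_power (2 * N) be mB Boo bB.
have le1 x : A x -> \int[mu]_(y in (B : set (lebR R))) phi (x, y) <=
    L ^+ 2 * IB * `|x - al| ^+ (2 * N).
  move=> Ax.
  have -> : L ^+ 2 * IB * `|x - al| ^+ (2 * N) =
      \int[mu]_(y in (B : set (lebR R)))
        (L ^+ 2 * `|x - al| ^+ (2 * N) * `|y - be| ^+ (2 * N)).
    by rewrite RintegralZl// -/IB; ring.
  apply: (le_Rintegral mB).
  - apply: (@integrable_bounded_on _ _ M mB Boo).
      exact: (lmeasurable_pair2 x mphi).
    by move=> y By; rewrite ger0_norm ?sqr_ge0//; exact: hM.
  - exact: (integrableZl mB _ iB).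
  - by move=> y _; exact: phi_le.
apply: (@le_trans _ _ (\int[mu]_(x in (A : set (lebR R)))
    (L ^+ 2 * IB * `|x - al| ^+ (2 * N)))).
  by apply: (le_Rintegral mA iphi (integrableZl mA _ iA)) => x; exact: le1.
by rewrite RintegralZl// -/IA -mulrA [IB * _]mulrC.
Qed.

Lemma moment_ge0 N E : 0 <= moment N E.
Proof.
apply: lb_le_inf; first by exists (\int[mu]_(x in (E : set (lebR R))) `|x - 0| ^+ (2 * N)), 0.
by move=> _ [a _ <-]; apply: Rintegral_ge0 => x _; rewrite exprn_ge0.
Qed.

(** [h] is the essential supremum of [g] on [E], built as the supremum of the levels exceeded on a
    subset of positive measure. The set where [g] exceeds [h] is the union of the null sets where it
    exceeds [h + 1 / (n + 1)]. *)
Lemma essential_max E (g : R -> R) (r : R) : measurable (E : set (lebR R)) ->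
  (0 < mu E)%E -> lmeasurable_fun g -> (forall x, E x -> `|g x| <= r) ->
  exists h : R,
    (forall t, t < h -> (0 < mu (E `&` [set x | (t < g x)%R]))%E) /\
    {ae mu, forall x, E x -> g x <= h}.
Proof.
move=> mE E0 mg gr.
pose S := [set t : R | (0 < mu (E `&` [set x | (t < g x)%R]))%E].
have mS t : measurable (E `&` [set x | t < g x] : set (lebR R)).
  have mI := mg measurableT `]t, +oo[%classic (measurable_itv _).
  rewrite setTI in mI.
  rewrite (_ : _ `&` _ = (E : set (lebR R)) `&` g @^-1` `]t, +oo[%classic).
    exact: measurableI.
  by congr (_ `&` _); apply/seteqP; split=> x /=; rewrite in_itv/= andbT.
have hS : has_sup S.
  split.
    exists (- r - 1); rewrite /S/= (_ : _ `&` _ = E)//.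
    apply/seteqP; split=> [x []//|x Ex]; split=> //=.
    by have := gr x Ex; rewrite ler_norml => /andP[+ _]; apply: lt_le_trans; lra.
  exists r => t; rewrite /S/= leNgt; apply: contraPN => rt.
  rewrite (_ : _ `&` _ = set0) ?measure0 ?ltxx//.
  apply/seteqP; split=> // x [Ex /= tx].
  have := gr x Ex; rewrite ler_norml => /andP[_].
  by rewrite leNgt (lt_trans rt tx).
exists (sup S); split.
  move=> t tS; have d0 : 0 < sup S - t by rewrite subr_gt0.
  have [u Su tu] := sup_adherent d0 hS.
  move: tu; rewrite subKr => tu.
  apply: lt_le_trans Su _; apply: le_measure; rewrite ?inE//.
  by move=> x [Ex /= ux]; split=> //=; exact: lt_trans tu ux.
have null n : mu (E `&` [set x | (sup S + n.+1%:R^-1 < g x)%R]) = 0%E.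
  apply/eqP; rewrite eq_le measure_ge0 andbT leNgt; apply/negP => pos.
  have : sup S + n.+1%:R^-1 <= sup S by apply: ub_le_sup pos; case: hS.
  by rewrite gerDl leNgt invr_gt0 ltr0n.
have neg : mu.-negligible (\bigcup_n (E `&` [set x | sup S + n.+1%:R^-1 < g x])).
  apply: negligible_bigcup => n; apply/negligibleP => //.
  exact: null.
apply: negligibleS neg => x /= /not_implyP[Ex /negP]; rewrite -ltNge => gx.
have [n _ nx] := near_infty_natSinv_lt (PosNum (eq_ind_r is_true gx (subr_gt0 (sup S) (g x)))).
exists n => //; split=> //=.
by have := nx n (leqnn n); rewrite /= ltrBrDl.
Qed.

End Moments.

(** * Comparison of the three envelopes *)

Section Envelope_inequalities.
Context {R : realType}.
Local Notation mu := (@completed_lebesgue_measure R).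
Local Notation lmeasurable_fun f := (measurable_fun [set: lebR R] (f : lebR R -> R)).
Implicit Types (A B E : set R).

(* The centre is that of the essential hull of [E], whose length is at most the
   essential diameter: otherwise a product of two sets of positive measure near
   its ends would violate the essential supremum. *)
Lemma essential_center E : measurable (E : set (lebR R)) -> (0 < mu E)%E ->
  bounded_set E ->
  exists a, {ae mu, forall x, E x -> `|x - a| <= diam_ess E / 2}.
Proof.
move=> mE E0 /bounded_setP[r Er].
have [h [hpos hae]] := essential_max mE E0 lmeasurable_id Er.
have ErN x : E x -> `|- x| <= r by rewrite normrN; exact: Er.
(* [l] is the essential supremum of [- x], so the essential hull is [[- l, h]], with midpoint
   [(h - l) / 2] and length [h + l]. *)
have [l [lpos lae]] := essential_max mE E0 (measurable_funN lmeasurable_id) ErN.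
exists ((h - l) / 2).
suff hl : h + l <= diam_ess E.
  apply: ae_imply2 hae lae => x xh xl Ex.
  have := xh Ex; have := xl Ex => /= ? ?.
  by rewrite ler_norml; apply/andP; split; lra.
pose F (z : lebR R * lebR R) : \bar R :=
  (if (z.1 \in E) && (z.2 \in E) then `|z.1 - z.2 : R| else 0)%:E.
pose s := ess_sup (mu \x mu)%E F.
(* Together with the lower bound below this makes [s] finite, so that [fine] in [diam_ess] returns
   the essential supremum itself. *)
have s_le : (s <= (2 * r)%:E)%E.
  apply/ess_supP; apply: aeW => z; rewrite lee_fin.
  have r0 : 0 <= r.
    have [x Ex] : E !=set0.
      by apply/set0P/negP => /eqP E00; move: E0; rewrite E00 measure0 ltxx.
    exact: le_trans (normr_ge0 _) (Er x Ex).
  case: ifPn => [/andP[/set_mem E1 /set_mem E2]|_]; last by rewrite mulr_ge0.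
  by have := Er _ E1; have := Er _ E2; have := ler_normB (z.1 : R) (z.2 : R); lra.
have le_s (e : R) : 0 < e -> ((h + l - 2 * e)%:E <= s)%E.
  move=> e0; rewrite leNgt; apply/negP => se.
  have he : h - e < h by rewrite ltrBlDr ltrDl.
  have le : l - e < l by rewrite ltrBlDr ltrDl.
  have hP := hpos _ he; have lP := lpos _ le.
  set P := E `&` [set x | _ < x] in hP; set Q := E `&` [set x | _ < - x] in lP.
  have mlt (g : R -> R) t : lmeasurable_fun g ->
      measurable (E `&` [set x | t < g x] : set (lebR R)).
    move=> mg; have mI := mg measurableT `]t, +oo[%classic (measurable_itv _).
    rewrite setTI in mI.
    rewrite (_ : _ `&` _ = (E : set (lebR R)) `&` g @^-1` `]t, +oo[%classic).
      exact: measurableI.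
    by congr (_ `&` _); apply/seteqP; split=> x /=; rewrite in_itv/= andbT.
  have mP : measurable (P : set (lebR R)) := mlt _ _ lmeasurable_id.
  have mQ : measurable (Q : set (lebR R)) := mlt _ _ (measurable_funN lmeasurable_id).
  have : {ae (mu \x mu)%E, forall z, (F z <= s)%E} by apply/ess_supP.
  move=> [Z [mZ Z0 FZ]].
  have : ((mu \x mu) ((P : set (lebR R)) `*` (Q : set (lebR R))) <= 0)%E.
    rewrite -Z0; apply: le_measure; rewrite ?inE//; first exact: measurableX.
    move=> [x y] [[/= Ex hx] [/= Ey ly]]; apply: FZ => /= Fs.
    have : (F (x, y) < (h + l - 2 * e)%:E)%E by exact: le_lt_trans Fs se.
    rewrite /F/= !mem_set//= lte_fin => lt.
    by have := ler_norm (x - y); lra.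
  by rewrite product_measure1E// leNgt mule_gt0.
have s_fin : s \is a fin_num.
  rewrite fin_numE; apply/andP; split; apply/eqP => s_inf.
    by have := le_s 1 ltr01; rewrite s_inf leeNy_eq.
  by move: s_le; rewrite s_inf leye_eq.
have sE : (diam_ess E)%:E = s by rewrite /diam_ess -[RHS]fineK.
apply/ler_addgt0Pr => e e0.
have e20 : 0 < e / 2 by rewrite divr_gt0.
have := le_s _ e20; rewrite -sE lee_fin.
by lra.
Qed.

(** A negative value would bound [|x - a|] by a negative number almost everywhere on [E], which is
    not null. *)
Lemma diam_ess_ge0 E : measurable (E : set (lebR R)) -> (0 < mu E)%E ->
  bounded_set E -> 0 <= diam_ess E.
Proof.
move=> mE E0 bE; have [a ae] := essential_center mE E0 bE.
rewrite leNgt; apply/negP => d0.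
have : mu.-negligible (E : set (lebR R)).
  apply: negligibleS ae => x Ex /(_ Ex); apply/negP; rewrite -ltNge.
  by apply: lt_le_trans (normr_ge0 _); rewrite pmulr_llt0.
by move/(measure_negligible mE) => E00; rewrite E00 ltxx in E0.
Qed.

(** The infimum is tested at the essential centre, where [|x - a|] is almost everywhere at most half
    the essential diameter. *)
Lemma moment_le_diam (N : nat) E : measurable (E : set (lebR R)) ->
  (0 < mu E < +oo)%E -> bounded_set E ->
  moment N E <= meas E * (diam_ess E / 2) ^+ (2 * N).
Proof.
move=> mE /andP[E0 Eoo] bE; have [a ae] := essential_center mE E0 bE.
have d0 := diam_ess_ge0 mE E0 bE.
apply: (@le_trans _ _ (\int[mu]_(x in (E : set (lebR R))) `|x - a| ^+ (2 * N))).
  apply: ge_inf; last by exists a.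
  by exists 0 => _ [b _ <-]; apply: Rintegral_ge0 => x _; rewrite exprn_ge0.
rewrite mulrC -(Rintegral_cst mu mE).
rewrite /Rintegral; apply: fine_le.
- exact: (integrable_fin_num mE (integrable_power (2 * N) a mE Eoo bE)).
- by rewrite (integral_cst mu mE) fin_numM// ge0_fin_numE.
apply: ae_ge0_le_integral.
- exact: mE.
- by move=> x _; rewrite lee_fin exprn_ge0.
- by apply: measurable_funTS; apply/measurable_EFinP; exact: lmeasurable_power.
- by move=> x _; rewrite lee_fin exprn_ge0// divr_ge0.
- exact: measurable_cst.
apply: ae_imply ae => x xd Ex; rewrite lee_fin.
by rewrite lerXn2r ?nnegrE ?normr_ge0 ?divr_ge0// xd.
Qed.

Variables (c : R) (M K : nat) (A B : set R).
Variables (Ai : 'I_M -> set R) (Bj : 'I_K -> set R) (N : 'M[nat]_(K, M)).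
Hypotheses (c0 : 0 < c) (PA : partition_nonnull Ai A) (PB : partition_nonnull Bj B).

(** For every pair of centres the Taylor polynomial is a competitor in the infimum on the left.
    Squaring turns the right-hand side into a product of two moments, in which the infima over the
    two centres are taken separately. *)
Lemma Ebest_le_Emom j i : Ebest c Ai Bj N j i <= Emom c Ai Bj N j i.
Proof.
have [_ /(_ i)[mA _ bA /andP[_ Aoo]] _ _] := PA.
have [_ /(_ j)[mB _ bB /andP[_ Boo]] _ _] := PB.
rewrite !mxE; set S := [set y | _]; set n := N j i.
have pc0 : 0 < 2 * pi * c by rewrite mulr_gt0// mulr_gt0// pi_gt0.
set L := (2 * pi * c) ^+ n / n`!%:R.
have L0 : 0 < L by rewrite divr_gt0 ?exprn_gt0// ltr0n fact_gt0.
have -> : (2 * pi * c) ^+ n * Num.sqrt c / n`!%:R *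
    Num.sqrt (moment n (Ai i) * moment n (Bj j)) =
    Num.sqrt c * (L * Num.sqrt (moment n (Ai i) * moment n (Bj j))).
  by rewrite /L; ring.
rewrite ler_wpM2l ?sqrtr_ge0//.
have S0 y : S y -> 0 <= y by case=> ? [? [? [_ ->]]]; exact: sqrtr_ge0.
have Sne : S !=set0.
  by exists (best_error c (Ai i) (Bj j) 0 0 0), 0, 0, 0; rewrite size_poly0.
have i0 : 0 <= inf S by apply: lb_le_inf.
rewrite mulrC -ler_pdivrMr//.
have q0 : 0 <= inf S / L by rewrite divr_ge0// ltW.
rewrite -[leLHS]ger0_norm// -sqrtr_sqr ler_wsqrtr//.
have mge0 (E : set R) (x : R) :
    [set \int[mu]_(x in (E : set (lebR R))) `|x - a| ^+ (2 * n) | a in [set: R]] x -> 0 <= x.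
  by move=> [a _ <-]; apply: Rintegral_ge0 => y _; rewrite exprn_ge0.
apply: le_mul_inf.
- by exists (\int[mu]_(x in (Ai i : set (lebR R))) `|x - 0| ^+ (2 * n)), 0.
- by exists (\int[mu]_(x in (Bj j : set (lebR R))) `|x - 0| ^+ (2 * n)), 0.
- exact: mge0.
- exact: mge0.
move=> _ _ [al _ <-] [be _ <-].
have I0 (E : set R) a : 0 <= \int[mu]_(x in (E : set (lebR R))) `|x - a| ^+ (2 * n).
  by apply: Rintegral_ge0 => x _; rewrite exprn_ge0.
rewrite -[leRHS]sqr_sqrtr ?mulr_ge0// lerXn2r ?nnegrE ?sqrtr_ge0//.
rewrite ler_pdivrMr// mulrC.
apply: le_trans (best_error_taylor_le al be n c0 mA Aoo bA mB Boo bB).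
apply: ge_inf; first by exists 0.
by exists al, be, (taylor_poly c n); split=> //; exact: size_poly.
Qed.

(** The constant [pi * c / 2] is [2 * pi * c] times the two factors 1/2 that come from the
    half-diameters. *)
Lemma Emom_le_Ediam j i : Emom c Ai Bj N j i <= Ediam c Ai Bj N j i.
Proof.
have [_ /(_ i)[mA _ bA A0oo] _ _] := PA.
have [_ /(_ j)[mB _ bB B0oo] _ _] := PB.
have /andP[A0 Aoo] := A0oo; have /andP[B0 Boo] := B0oo.
rewrite !mxE; set n := N j i.
have pc0 : 0 < 2 * pi * c by rewrite mulr_gt0// mulr_gt0// pi_gt0.
have dA := diam_ess_ge0 mA A0 bA; have dB := diam_ess_ge0 mB B0 bB.
have a0 : 0 <= meas (Ai i) by rewrite /meas fine_ge0.
have b0 : 0 <= meas (Bj j) by rewrite /meas fine_ge0.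
have mm : moment n (Ai i) * moment n (Bj j) <= (meas (Ai i) * meas (Bj j)) *
    ((diam_ess (Ai i) / 2 * (diam_ess (Bj j) / 2)) ^+ n) ^+ 2.
  apply: (@le_trans _ _ (meas (Ai i) * (diam_ess (Ai i) / 2) ^+ (2 * n) *
    (meas (Bj j) * (diam_ess (Bj j) / 2) ^+ (2 * n)))).
    by apply: ler_pM; rewrite ?moment_ge0 ?moment_le_diam.
  rewrite [(2 * n)%N]mulnC !exprM le_eqVlt; apply/orP; left; apply/eqP.
  by rewrite [in RHS]exprMn; ring.
have w0 : 0 <= (diam_ess (Ai i) / 2 * (diam_ess (Bj j) / 2)) ^+ n.
  by rewrite exprn_ge0// mulr_ge0// divr_ge0.
have ab0 : 0 <= meas (Ai i) * meas (Bj j) by rewrite mulr_ge0.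
have := ler_wsqrtr mm; rewrite (sqrtrM _ ab0) sqrtr_sqr ger0_norm// => sm.
apply: (@le_trans _ _ ((2 * pi * c) ^+ n * Num.sqrt c / n`!%:R *
  (Num.sqrt (meas (Ai i) * meas (Bj j)) *
   (diam_ess (Ai i) / 2 * (diam_ess (Bj j) / 2)) ^+ n))).
  rewrite ler_wpM2l// divr_ge0 ?ler0n// mulr_ge0 ?sqrtr_ge0// exprn_ge0//.
  exact: ltW.
rewrite le_eqVlt; apply/orP; left; apply/eqP.
rewrite -[c * _ * _]mulrA (sqrtrM _ (ltW c0)).
have -> : pi * c / 2 * diam_ess (Ai i) * diam_ess (Bj j) =
    (2 * pi * c) * (diam_ess (Ai i) / 2 * (diam_ess (Bj j) / 2)) by field.
by rewrite [in RHS]exprMn; ring.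
Qed.

End Envelope_inequalities.

(** * Eigenvectors of [T^* T] and the range of a spectral projection *)

Section Adjoint.
Context {R : realType}.
Local Notation C := R[i].
Implicit Types (f g : fn R) (T : op R).

Lemma adjointP T : is_adjoint T (Defs.adjoint T) \/ Defs.adjoint T = (fun _ _ => 0).
Proof.
rewrite /Defs.adjoint; case: xgetP => [S -> TS|_]; first by left.
by right.
Qed.

Lemma ae_refl f : ae_eq_fn f f.
Proof. by apply: aeW. Qed.

Lemma inner0l f : inner (fun=> 0) f = 0.
Proof. by rewrite /inner -[RHS]cintegral0; apply: eq_cintegral => x; rewrite mul0r. Qed.

(** For a genuine adjoint this is an equality; the inequality is also satisfied by the zero
    default. *)
Lemma Re_inner_adjoint_le T f : L2 f -> L2 (T f) ->
  complex.Re (inner (Defs.adjoint T (T f)) f) <= sqnorm (T f).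
Proof.
move=> Lf LTf; have [[LS adj]|->] := adjointP T; last first.
  by rewrite inner0l sqnorm_ge0.
by rewrite (innerJ Lf (LS _ LTf)) cReJ -adj// inner_self.
Qed.

(** If the [f k] are orthonormal eigenvectors with eigenvalues [m k >= l], their images are
    orthogonal with squared norms [m k]. Hence every combination [g] satisfies [|T g|^2 >= l |g|^2],
    and the combination supplied by the last hypothesis gives [l <= r ^+ 2 + t] for every
    [t > 0]. *)
Lemma L2_singular_value_le T (n : nat) (r : R) : 0 <= r ->
  (forall f, L2 f -> L2 (T f)) ->
  (forall (a : 'I_n -> C) (f : 'I_n -> fn R), (forall k, L2 (f k)) ->
     T (lincomb a f) = lincomb a (fun k => T (f k))) ->
  (forall (f : 'I_n -> fn R) (t : R), (forall k, L2 (f k)) -> 0 < t ->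
    exists a : 'I_n -> C, (exists k, a k != 0) /\
      sqnorm (T (lincomb a f)) <= (r ^+ 2 + t) * sqnorm (lincomb a f)) ->
  (singular_value T n <= r%:E)%E.
Proof.
move=> r0 LT linT small.
apply: ge_ereal_sup => _ [l [f [[Lf orth] eig]] <-].
rewrite lee_fin -[leRHS]ger0_norm// -sqrtr_sqr ler_wsqrtr//.
apply/ler_addgt0Pr => t t0.
have [a [[k0 ak0] Ta]] := small f t Lf t0.
pose s := \sum_k Normc.normc (a k) ^+ 2.
have s0 : 0 < s.
  rewrite /s (bigD1 k0)//= ltr_pwDl ?sumr_ge0// => [|k _]; last by rewrite sqr_ge0.
  rewrite exprn_gt0// lt_neqAle normc_nneg andbT eq_sym.
  by apply: contra ak0 => /eqP/Normc.eq0_normc ->.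
have Lg := L2_lincomb a Lf.
have sqE : sqnorm (lincomb a f) = s.
  apply: complexI; rewrite -inner_self// inner_lincombl//.
  rewrite /s rmorph_sum; apply: eq_bigr => k _.
  rewrite inner_lincombr// (bigD1 k)//= big1 ?addr0 => [|j jk]; last first.
    by rewrite orth eq_sym (negbTE jk) mulr0.
  rewrite orth eqxx mulr1; case: (a k) => x y.
  by apply: complex_ext; rewrite ?cReM ?cImM /= ?sqr_sqrtr ?addr_ge0 ?sqr_ge0//; ring.
have [m mP] : exists m : 'I_n -> R, forall k, l <= m k /\
    ae_eq_fn (Defs.adjoint T (T (f k))) (fun x => (m k)%:C%C * f k x).
  have /choice[m mP] : forall k, exists m : R, l <= m /\
    ae_eq_fn (Defs.adjoint T (T (f k))) (fun x => m%:C%C * f k x).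
    by move=> k; have [m lm ae] := eig k; exists m.
  by exists m.
have inner_eig k j : inner (fun x => (m k)%:C%C * f k x) (f j) =
    (m k)%:C%C * (k == j)%:R.
  rewrite /inner -orth -cintegralZ; last exact: inner_cintegrable.
  by apply: eq_cintegral => x; rewrite mulrA.
(* For the zero default the eigenvalue equation forces [m k0 = 0], so that [l <= 0]. *)
have [[LS adj]|adj0] := adjointP T; last first.
  have [lm ae] := mP k0.
  have : inner (fun=> 0) (f k0) = inner (fun x => (m k0)%:C%C * f k0 x) (f k0).
    rewrite adj0 in ae.
    exact: ae_inner L2_0 (L2Z _ (Lf k0)) (Lf k0) (Lf k0) ae (ae_refl _).
  rewrite inner0l inner_eig eqxx mulr1 => -[m0].
  by rewrite (le_trans lm)// -m0 addr_ge0 ?sqr_ge0// ltW.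
have TTE j k : inner (T (f j)) (T (f k)) = (m k)%:C%C * (j == k)%:R.
  rewrite (adj _ _ (Lf j) (LT _ (Lf k))).
  rewrite (innerJ (LS _ (LT _ (Lf k))) (Lf j)).
  have -> : inner (Defs.adjoint T (T (f k))) (f j) =
      inner (fun x => (m k)%:C%C * f k x) (f j).
    exact: ae_inner (LS _ (LT _ (Lf k))) (L2Z _ (Lf k)) (Lf j) (Lf j)
      (mP k).2 (ae_refl _).
  by rewrite inner_eig cJM conjc_real conjc_nat eq_sym.
have TE : sqnorm (T (lincomb a f)) = \sum_k m k * Normc.normc (a k) ^+ 2.
  have LTf k : L2 (T (f k)) by exact: LT.
  have LTg := L2_lincomb a LTf.
  rewrite (linT _ _ Lf); apply: complexI.
  rewrite -(inner_self LTg) (inner_lincombl _ LTf LTg).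
  rewrite rmorph_sum; apply: eq_bigr => k _.
  rewrite (inner_lincombr _ LTf (LTf k)).
  rewrite (bigD1 k)//= big1 ?addr0 => [|j jk]; last first.
    by rewrite TTE eq_sym (negbTE jk) !mulr0.
  rewrite TTE eqxx mulr1; case: (a k) => x y.
  by apply: complex_ext; rewrite ?cReM ?cImM /= ?sqr_sqrtr ?addr_ge0 ?sqr_ge0//; ring.
have lT : l * s <= sqnorm (T (lincomb a f)).
  rewrite TE /s mulr_sumr; apply: ler_sum => k _.
  by rewrite ler_wpM2r ?sqr_ge0//; exact: (mP k).1.
by rewrite -(ler_pM2r s0) (le_trans lT)// -sqE.
Qed.

Lemma ae_lincomb n (a : 'I_n -> C) (f g : 'I_n -> fn R) :
  (forall k, ae_eq_fn (f k) (g k)) -> ae_eq_fn (lincomb a f) (lincomb a g).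
Proof.
move=> fg; rewrite /ae_eq_fn /lincomb.
elim: n a f g fg => [|n IH] a f g fg; first by apply: aeW => x; rewrite !big_ord0.
have := IH (fun k => a (lift ord0 k)) (fun k => f (lift ord0 k))
  (fun k => g (lift ord0 k)) (fun k => fg _).
apply: ae_imply2 (fg ord0) => x f0 fS.
by rewrite !big_ord_recl f0 fS.
Qed.

Lemma linear_op_lincomb (P : op R) n (a : 'I_n -> C) (f : 'I_n -> fn R) :
  linear_op P -> (forall k, L2 (f k)) ->
  ae_eq_fn (P (lincomb a f)) (lincomb a (fun k => P (f k))).
Proof.
move=> [LP aeP linP] Lf.
have P0 : ae_eq_fn (P (fun=> 0)) (fun=> 0).
  (* [linear_op] speaks only of [a f + g]; with [a = -1] and zero functions it reads
     [P 0 = - P 0 + P 0]. *)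
  have := linP (-1) (fun=> 0) (fun=> 0) L2_0 L2_0.
  rewrite (_ : (fun x => _) = fun=> 0); last first.
    by apply/funext => x; rewrite mulr0 addr0.
  by apply: ae_imply => x ->; rewrite mulN1r addNr.
elim: n a f Lf => [|n IH] a f Lf.
  have -> : lincomb a f = fun=> 0 by apply/funext => x; rewrite /lincomb big_ord0.
  by apply: ae_imply P0 => x ->; rewrite /lincomb big_ord0.
pose a' k := a (lift ord0 k); pose f' k := f (lift ord0 k).
have -> : lincomb a f = fun x => a ord0 * f ord0 x + lincomb a' f' x.
  by apply/funext => x; rewrite /lincomb big_ord_recl.
have Lf' k : L2 (f' k) by exact: Lf.
have := linP (a ord0) (f ord0) (lincomb a' f') (Lf _) (L2_lincomb _ Lf').
apply: ae_imply2 (IH a' f' Lf') => x IHx ->.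
by rewrite IHx /lincomb big_ord_recl.
Qed.

(* On the range of [E X], [X] the open interval, the measure representing the
   quadratic form is carried by [X]. *)
Lemma spectral_range_gt (T' : op R) (E : set R -> op R) (eps b : R) f :
  is_spectral_measure T' E -> L2 f -> ae_eq_fn (E `]eps, b[%classic f) f ->
  0 < sqnorm f -> eps * sqnorm f < complex.Re (inner (T' f) f).
Proof.
move=> [projE Esetup _ quad] Lf EXf f0; set X := `]eps, b[%classic in EXf.
have mX : measurable X by exact: measurable_itv.
have [m [mE im ->]] := quad f Lf.
have [[LX _ _] _ _] := projE X mX.
have [[LT _ _] _ _] := projE setT measurableT.
have mXE : m X = (sqnorm f)%:E.
  rewrite mE// (ae_inner (LX _ Lf) Lf Lf Lf EXf (ae_refl _)).
  by rewrite inner_self.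
have mTE : m setT = (sqnorm f)%:E.
  rewrite mE// (ae_inner (LT _ Lf) Lf Lf Lf (Esetup _ Lf) (ae_refl _)).
  by rewrite inner_self.
(* [X] and the whole line have the same finite mass, the squared norm of [f]. *)
have mXC : m (~` X) = 0%E.
  have mU := measureU m mX (measurableC mX) (setICr X).
  rewrite setUv in mU; 
  have e : ((sqnorm f)%:E = (sqnorm f)%:E + m (~` X))%E.
    by rewrite -[in RHS]mXE -mTE; exact: mU.
  have : (0 <= m (~` X))%E by exact: measure_ge0.
  move: e; case: (m (~` X)) => [u|//|//] [e] _; congr (_%:E).
  by lra.
have ieps : m.-integrable setT (EFin \o cst eps).
  apply: measurable_bounded_integrable => //; first by rewrite mTE ltry.
  exact: bounded_cst.
have iX : m.-integrable setT (EFin \o (fun t : R => t - eps)).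
  exact: (integrableB measurableT im ieps).
have iXX : m.-integrable X (EFin \o (fun t : R => t - eps)).
  exact: integrableS iX.
have Xpos t : X t -> 0 < t - eps.
  by rewrite /X/= in_itv/= subr_gt0 => /andP[].
have intE : (\int[m]_t (t - eps)%:E = \int[m]_(t in X) (t - eps)%:E)%E.
  rewrite -[in LHS](setUv X) integral_setU_EFin ?setUv//; last 3 first.
  - exact: measurableC.
  - by move/measurable_int/measurable_EFinP : iX.
  - by apply/disj_setPCl.
  rewrite [X in (_ + X)%E](_ : _ = 0%E) ?adde0//.
  apply: (null_set_integral (measurableC mX) _ mXC).
  by apply: measurable_funTS; move/measurable_int : iX.
have -> : complex.Re ((\int[m]_t t)%:C)%C =
    \int[m]_t (t - eps) + eps * sqnorm f.
  by rewrite RintegralB// Rintegral_cst// mTE/= subrK.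
rewrite ltrDr lt_neqAle /Rintegral intE; apply/andP; split; last first.
  by apply/fine_ge0/integral_ge0 => t /Xpos/ltW; rewrite lee_fin.
(* Strictness: [t - eps] is positive on [X], so a zero integral would make [X] null, whereas its
   mass is the positive squared norm of [f]. *)
apply/negP => /eqP int0.
have abs0 : (\int[m]_(t in X) `|(EFin \o (fun t : R => (t - eps)%R)) t| = 0)%E.
  have I0 : (\int[m]_(t in X) (t - eps)%:E = 0)%E.
    rewrite -[LHS]fineK; last exact: (integrable_fin_num mX iXX).
    by rewrite -int0.
  rewrite -I0; apply: eq_integral => t /set_mem/Xpos/ltW t0.
  by rewrite /= ger0_norm.
have := (ae_eq_integral_abs m mX (measurable_int _ iXX)).1 abs0.
move=> ae0; have : m.-negligible X.
  apply: negligibleS ae0 => t Xt /(_ Xt)/= [] t0.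
  by have := Xpos t Xt; rewrite t0 ltxx.
move=> /(measure_negligible mX) mX0.
by have [f00] := etrans (esym mXE) mX0; rewrite f00 ltxx in f0.
Qed.

End Adjoint.

(** * Rank of a spectral projection *)

Section Spectral_rank.
Context {R : realType}.
Local Notation C := R[i].
Implicit Types (f g : fn R) (T : op R).

Lemma inner_lincomb n (a : 'I_n -> C) (g : 'I_n -> fn R) : (forall k, L2 (g k)) ->
  inner (lincomb a g) (lincomb a g) = sesqui (fun k l => inner (g k) (g l)) a a.
Proof.
move=> Lg; rewrite (inner_lincombl _ Lg (L2_lincomb a Lg)); apply: eq_bigr => k _.
by rewrite (inner_lincombr _ Lg (Lg k)) mulr_sumr; apply: eq_bigr => l _; rewrite mulrA.
Qed.

Lemma sqnorm_lincomb n (a : 'I_n -> C) (g : 'I_n -> fn R) : (forall k, L2 (g k)) ->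
  sqnorm (lincomb a g) = complex.Re (sesqui (fun k l => inner (g k) (g l)) a a).
Proof. by move=> Lg; rewrite -inner_lincomb// (inner_self (L2_lincomb a Lg)). Qed.

Lemma sum_sqr_gt0 n (a : 'I_n -> C) : (exists k, a k != 0) ->
  0 < \sum_k Normc.normc (a k) ^+ 2.
Proof.
move=> [k ak]; rewrite (bigD1 k)//= ltr_pwDl//; last first.
  by rewrite sumr_ge0// => j _; rewrite sqr_ge0.
rewrite exprn_gt0// lt_neqAle normc_nneg andbT eq_sym.
by apply: contra ak => /eqP/Normc.eq0_normc ->.
Qed.

Lemma spectral_measureP T : is_spectral_measure T (spectral_measure T) \/
  spectral_measure T = (fun _ _ _ => 0).
Proof.
rewrite /spectral_measure; case: xgetP => [E -> spE|_]; first by left.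
by right.
Qed.

(** Independence of the projected vectors makes the hermitian form of the overview positive definite
    in the coefficients, so it dominates a multiple of [sum_k |a_k|^2]. The slack [t] can thus be
    fixed before the coefficients [a] are produced. *)
Lemma oprank_spectral_le T (m : nat) (r eps b : R) : r ^+ 2 <= eps ->
  (forall f, L2 f -> L2 (T f)) ->
  (forall n (a : 'I_n -> C) (f : 'I_n -> fn R), (forall k, L2 (f k)) ->
     T (lincomb a f) = lincomb a (fun k => T (f k))) ->
  (forall n (f : 'I_n -> fn R) (t : R), (m < n)%N -> (forall k, L2 (f k)) -> 0 < t ->
    exists a : 'I_n -> C, (exists k, a k != 0) /\
      sqnorm (T (lincomb a f)) <= (r ^+ 2 + t) * sqnorm (lincomb a f)) ->
  (oprank (spectral_measure (fun f => Defs.adjoint T (T f)) `]eps, b[%classic)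
     <= m%:R%:E)%E.
Proof.
move=> reps LT linT small.
apply: ge_ereal_sup => _ [n [f [Lf indep]] <-].
rewrite lee_fin ler_nat leqNgt; apply/negP => mn.
set T' : op R := fun f => Defs.adjoint T (T f) in indep.
case: (spectral_measureP T') => [|E0]; last first.
  (* With the zero default all range vectors vanish, so no positive number of them is
     independent. *)
  rewrite E0 in indep.
  have n0 : (0 < n)%N by exact: leq_ltn_trans mn.
  have zero : ae_eq_fn (lincomb (fun=> 1) (fun (_ : 'I_n) (_ : R) => 0 : C)) (fun=> 0).
    by apply: aeW => x; rewrite /lincomb big1// => k _; rewrite mulr0.
  by have /eqP := indep _ zero (Ordinal n0); rewrite oner_eq0.
move: (spectral_measure T') indep => E indep spE.
set X := `]eps, b[%classic in indep.
have mX : measurable X by exact: measurable_itv.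
have [proj_E _ _ _] := spE.
have [linE idem _] := proj_E X mX.
pose g k := E X (f k).
have Lg k : L2 (g k) by case: linE => LE _ _; exact: LE (Lf k).
have LTg k : L2 (T (g k)) by exact: LT.
pose H k l := inner (T (g k)) (T (g l)) - eps%:C%C * inner (g k) (g l).
have HE a : complex.Re (sesqui H a a) =
    sqnorm (T (lincomb a g)) - eps * sqnorm (lincomb a g).
  rewrite (linT _ _ _ Lg) (sqnorm_lincomb a LTg) (sqnorm_lincomb a Lg).
  rewrite (_ : sesqui H a a = sesqui (fun k l => inner (T (g k)) (T (g l))) a a -
      eps%:C%C * sesqui (fun k l => inner (g k) (g l)) a a); last first.
    rewrite /sesqui mulr_sumr -sumrB; apply: eq_bigr => k _.
    by rewrite mulr_sumr -sumrB; apply: eq_bigr => l _; rewrite /H; ring.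
  by rewrite cReD cReN cReM /= mul0r subr0.
have herm k l : H l k = (H k l)^*%C.
  rewrite /H (innerJ (LTg k) (LTg l)) (innerJ (Lg k) (Lg l)).
  case: (inner (T _) _) => ? ?; case: (inner _ _) => ? ?.
  by apply: complex_ext => /=; ring.
have pos a : (exists k, a k != 0) -> 0 < complex.Re (sesqui H a a).
  move=> [k ak]; rewrite HE subr_gt0.
  have Lag := L2_lincomb a Lg.
  apply: lt_le_trans (Re_inner_adjoint_le Lag (LT _ Lag)).
  (* The combination lies in the range of [E X]: each [g k] is fixed by idempotence and the
     combination by linearity. Its norm is positive because the [g k] are independent. *)
  apply: (@spectral_range_gt _ T' E eps b) => //.
    have := ae_lincomb a (fun k => idem _ (Lf k)).
    by apply: ae_imply2 (linear_op_lincomb a linE Lg) => x -> ->.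
  rewrite lt_neqAle sqnorm_ge0 andbT eq_sym; apply: contra ak => /eqP s0.
  by rewrite (indep a (sqnorm_eq0 Lag s0) k).
have [q q0 qP] := posdef_lower herm pos.
pose D := \sum_k \sum_l Normc.normc (inner (g k) (g l)).
have D0 : 0 <= D.
  by rewrite sumr_ge0// => k _; rewrite sumr_ge0// => l _; rewrite normc_nneg.
have D1 : 0 < D + 1 by rewrite ltr_wpDl.
(* With [s = sum_k |a_k|^2] and [g] the combination, [s <= q (|T g|^2 - eps |g|^2) <= q t |g|^2 <= q
   t D s]. This choice of [t] makes the last coefficient [D / (D + 1)], which is less than 1. *)
pose t := (q * (D + 1))^-1.
have t0 : 0 < t by rewrite invr_gt0 mulr_gt0.
have [a [a0 Ta]] := small n g t mn Lg t0.
have := sum_sqr_gt0 a0; have := qP a; rewrite HE; set s := \sum_k _ => qs s0.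
have gD : sqnorm (lincomb a g) <= D * s.
  by rewrite (sqnorm_lincomb a Lg); exact: sesqui_le.
have ts : t * sqnorm (lincomb a g) <= t * (D * s) by rewrite ler_wpM2l// ltW.
have re : r ^+ 2 * sqnorm (lincomb a g) <= eps * sqnorm (lincomb a g).
  by rewrite ler_wpM2r// sqnorm_ge0.
have : s <= q * (t * (D * s)).
  apply: le_trans qs _; rewrite ler_wpM2l ?(ltW q0)//.
  by move: Ta; rewrite mulrDl; lra.
have -> : q * (t * (D * s)) = D / (D + 1) * s.
  by rewrite /t; field; rewrite !gt_eqF.
rewrite ler_pMl// leNgt => /negP; apply.
by rewrite ltr_pdivrMr// mul1r ltrDl.
Qed.

End Spectral_rank.

Theorem theorem5p7 (R : realType) (c : R) (M K : nat) (A B : set R)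
    (Ai : 'I_M -> set R) (Bj : 'I_K -> set R) (N : 'M[nat]_(K, M)) :
  0 < c ->
  partition_nonnull Ai A ->
  partition_nonnull Bj B ->
  let best := Ebest c Ai Bj N in
  let mom := Emom c Ai Bj N in
  let diam := Ediam c Ai Bj N in
  let total := (\sum_(j < K) \sum_(i < M) N j i)%N in
  [/\ (singular_value (locop A B c) (1 + total) <= (opnorm best)%:E)%E,
      forall j i, [/\ 0 <= best j i, best j i <= mom j i & mom j i <= diam j i],
      opnorm best <= opnorm mom /\ opnorm mom <= opnorm diam &
      forall eps : R, 0 < eps < 1 / 2 ->
        [\/ opnorm best <= Num.sqrt eps, opnorm mom <= Num.sqrt eps
          | opnorm diam <= Num.sqrt eps] ->
        (spectral_count eps A B c <= total%:R%:E)%E].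
Proof.
move=> c0 PA PB best mom diam total.
have [mA _ _ _] := PA; have [mB _ _ _] := PB.
have Aoo := partition_measure_lty PA; have Boo := partition_measure_lty PB.
have best0 j i : 0 <= best j i by exact: Ebest_ge0.
have best_mom j i : best j i <= mom j i by exact: Ebest_le_Emom c0 PA PB j i.
have mom_diam j i : mom j i <= diam j i by exact: Emom_le_Ediam c0 PA PB j i.
have bm : opnorm best <= opnorm mom.
  by apply: le_opnorm => j i; rewrite best0 best_mom.
have md : opnorm mom <= opnorm diam.
  by apply: le_opnorm => j i; rewrite mom_diam andbT;
    exact: le_trans (best0 j i) (best_mom j i).
have LT := L2_locop c0 mA Aoo mB Boo.
have linT n (a : 'I_n -> R[i]) (f : 'I_n -> fn R) (Lf : forall k, L2 (f k)) :=
  @locop_lincomb R A B c mA Aoo n a f Lf.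
have small := @small_lincomb R c M K A B Ai Bj N c0 PA PB.
split.
- apply: (L2_singular_value_le (opnorm_ge0 _) LT (@linT _)) => f t Lf t0.
  exact: small (ltnSn _) Lf t0.
- by [].
- by [].
move=> eps /andP[eps0 _] small_norm.
have le_eps : opnorm best <= Num.sqrt eps.
  case: small_norm => h; [exact: h|exact: le_trans bm h|].
  exact: le_trans bm (le_trans md h).
have sqr_le : opnorm best ^+ 2 <= eps.
  have := opnorm_ge0 best; move: (opnorm best) le_eps => r r_le r0.
  by rewrite -(sqr_sqrtr (ltW eps0)) lerXn2r ?nnegrE ?sqrtr_ge0.
exact: oprank_spectral_le sqr_le LT linT small.
Qed.
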